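(* Let $d\geqslant 4$ and $N$ be integers, let $i,k$ be integers with $1\leqslant i\leqslant k\leqslant N$ and $N+i\geqslant 2k$, and let $P\subset{\mathbb P}^N$ be a $k$-dimensional linear subspace. Then $$\mathop{\rm codim}{\cal P}^{(i,k;k)}_{d,N+1}(P)\geqslant \binom{d+k}{k}+(N+i-2k)\,\tau(d-1,k,i).$$
   Context: ${\cal P}_{d,N+1}$ is the complex vector space of homogeneous polynomials of degree $d$ in $x_0,\dots,x_N$; codimension is that of the Zariski closure in ${\cal P}_{d,N+1}$. For $f\ne 0$, $\mathop{\rm Sing}(f)$ is the singular set of $\{f=0\}\subset{\mathbb P}^N$ ($\mathop{\rm Sing}(0)={\mathbb P}^N$); $\mathop{\rm Sing}(f|_P)\subset P$ is the singular set of $\{f|_P=0\}$ in $P\cong{\mathbb P}^k$ (equal to $P$ if $f|_P\equiv0$). $\langle C\rangle$ is the linear span of $C$. ${\cal P}^{(i,k;l)}_{d,N+1}(P)$ is the Zariski closure of the set of $f$ such that $\mathop{\rm Sing}(f)$ has an irreducible component $C\subset P$ of dimension $i$ with $\langle C\rangle=P$, and $\mathop{\rm Sing}(f|_P)$ has an irreducible component $B$ of dimension $l$ with $C\subset B$. For positive integers $a,b,c$, $\tau(a,b,c)=\max\left\{\binom{a+c}{c},\ ab+1\right\}$. *)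

(* Defs.v *)
From HB Require Import structures.
From mathcomp Require Import all_boot all_order all_algebra.
From mathcomp Require Import mpoly.
From mathcomp.real_closed Require Import complex.
From mathcomp.reals_stdlib Require Import Rstruct.
From Stdlib Require Rdefinitions.

Set Implicit Arguments.
Unset Strict Implicit.
Unset Printing Implicit Defensive.

Import GRing.Theory Num.Theory.

Notation CC := ((Rdefinitions.R)[i]).

(* Generic combinatorial topology: a space is a carrier T together with a   *)
(* predicate [cl] singling out its closed subsets.                          *)

Definition subs (T : Type) (A B : T -> Prop) := forall x, A x -> B x.

Definition zclosure (T : Type) (cl : (T -> Prop) -> Prop) (X : T -> Prop) :
  T -> Prop := fun x => forall Z, cl Z -> subs X Z -> Z x.

Definition irreducible (T : Type) (cl : (T -> Prop) -> Prop) (Z : T -> Prop) :=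
  [/\ cl Z, (exists x, Z x) &
      forall A B, cl A -> cl B -> subs Z (fun x => A x \/ B x) ->
                  subs Z A \/ subs Z B].

Definition irr_component (T : Type) (cl : (T -> Prop) -> Prop)
    (X Z : T -> Prop) :=
  [/\ irreducible cl Z, subs Z X &
      forall W, irreducible cl W -> subs Z W -> subs W X -> subs W Z].

Definition chain_in (T : Type) (cl : (T -> Prop) -> Prop) (X : T -> Prop)
    (n : nat) :=
  exists c : nat -> (T -> Prop),
    (forall j : nat, (j <= n)%N -> irreducible cl (c j) /\ subs (c j) X) /\
    (forall j : nat, (j < n)%N -> subs (c j) (c j.+1) /\ ~ subs (c j.+1) (c j)).

Definition has_dim (T : Type) (cl : (T -> Prop) -> Prop) (X : T -> Prop)
    (n : nat) :=
  chain_in cl X n /\ ~ chain_in cl X n.+1.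

(* Projective space P^{n-1}: points are represented by nonzero vectors of   *)
(* C^n (row vectors); closed sets are common zero loci (among nonzero       *)
(* vectors) of families of homogeneous polynomials.                          *)

Definition ev (n : nat) (p : {mpoly CC[n]}) (x : 'rV[CC]_n) : CC :=
  p.@[fun j => x ord0 j].

Definition proj_closed (n : nat) (Z : 'rV[CC]_n -> Prop) :=
  exists G : {mpoly CC[n]} -> Prop,
    (forall g, G g -> exists e : nat, g \is e.-homog) /\
    (forall x, Z x <-> (x != 0%R /\ forall g, G g -> ev g x = 0%R)).

(* Sing(f): singular set of the hypersurface {f = 0} in P^{n-1}
   (equal to all of P^{n-1} when f = 0). *)
Definition Sing (n : nat) (f : {mpoly CC[n]}) (x : 'rV[CC]_n) :=
  [/\ x != 0%R, ev f x = 0%R & forall j : 'I_n, ev (f^`M(j)) x = 0%R].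

(* Sing(f|_P) for a linear subspace P (given as the row space of the matrix
   P): points x of P where f|_P vanishes and its differential along P
   vanishes (equal to all of P when f|_P = 0). *)
Definition SingRestr (n : nat) (f : {mpoly CC[n]}) (P : 'M[CC]_n)
    (x : 'rV[CC]_n) :=
  [/\ x != 0%R, (x <= P)%MS, ev f x = 0%R &
      forall v : 'rV[CC]_n, (v <= P)%MS ->
        (\sum_(j < n) v ord0 j * ev (f^`M(j)) x = 0)%R].

Definition span_eq (n : nat) (C : 'rV[CC]_n -> Prop) (P : 'M[CC]_n) :=
  (forall v, C v -> (v <= P)%MS) /\
  (forall m (Q : 'M[CC]_(m, n)), (forall v, C v -> (v <= Q)%MS) -> (P <= Q)%MS).

(* The affine space P_{d,n} of homogeneous polynomials of degree d in n     *)
(* variables with its Zariski topology: closed sets are common zero loci    *)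
(* of polynomial functions in the coefficients.                              *)

Inductive coord_fun (n : nat) : ({mpoly CC[n]} -> CC) -> Prop :=
| cf_const (c : CC) : coord_fun (fun _ => c)
| cf_coef (m : 'X_{1..n}) : coord_fun (fun f => (f@_m)%R)
| cf_add a b : coord_fun a -> coord_fun b -> coord_fun (fun f => (a f + b f)%R)
| cf_mul a b : coord_fun a -> coord_fun b -> coord_fun (fun f => (a f * b f)%R).

Definition Pd (n d : nat) (f : {mpoly CC[n]}) : Prop := f \is d.-homog.
Arguments Pd : clear implicits.

Definition homog_closed (n d : nat) (Z : {mpoly CC[n]} -> Prop) :=
  exists F : ({mpoly CC[n]} -> CC) -> Prop,
    (forall a, F a -> coord_fun a) /\
    (forall f, Z f <-> (Pd n d f /\ forall a, F a -> a f = 0%R)).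
Arguments homog_closed : clear implicits.

Definition codim_geq (n d : nat) (S : {mpoly CC[n]} -> Prop) (c : nat) :=
  forall D m : nat,
    has_dim (homog_closed n d) (Pd n d) D ->
    has_dim (homog_closed n d) (zclosure (homog_closed n d) S) m ->
    (c + m <= D)%N.
Arguments codim_geq : clear implicits.

Definition sigma_set (N d i l : nat) (P : 'M[CC]_N.+1) (f : {mpoly CC[N.+1]}) :=
  Pd N.+1 d f /\
  exists C : 'rV[CC]_N.+1 -> Prop,
    [/\ irr_component (@proj_closed N.+1) (Sing f) C,
        subs C (fun x => (x <= P)%MS),
        has_dim (@proj_closed N.+1) C i,
        span_eq C P &
        exists B : 'rV[CC]_N.+1 -> Prop,
          [/\ irr_component (@proj_closed N.+1) (SingRestr f P) B,
              has_dim (@proj_closed N.+1) B l & subs C B]].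
Arguments sigma_set : clear implicits.

(* P^{(i,k;l)}_{d,N+1}(P): the Zariski closure.  (k is recorded by P.) *)
Definition Pikl (N d i l : nat) (P : 'M[CC]_N.+1) : {mpoly CC[N.+1]} -> Prop :=
  zclosure (homog_closed N.+1 d) (sigma_set N d i l P).
Arguments Pikl : clear implicits.

Definition tau (a b c : nat) : nat := maxn 'C(a + c, c) (a * b + 1).

(* Main.v *)
Require Import Defs.
From HB Require Import structures.
From mathcomp Require Import all_boot all_order all_algebra.
From mathcomp Require Import perm mpoly zify.
From mathcomp.real_closed Require Import complex.
From mathcomp.reals_stdlib Require Import Rstruct.
From Stdlib Require Import Classical FunctionalExtensionality.

(** Write [e = d - 1]. If [f] lies in the set, then [f] vanishes on [P], and its
    [N - k] normal derivatives are forms of degree [e] on [P = P^k] vanishing on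
    an irreducible nondegenerate [C] of dimension [i]. Some [i + 1] coordinates
    are algebraically independent on [C], and forms of degree [e] restricted to
    [C] span a space of dimension at least [tau e k i] (monomials in those
    coordinates give the binomial bound, Hopf's inequality
    [dim AB >= dim A + dim B - 1] gives [e k + 1]). So one can choose
    [tau e k i] points of [C] imposing independent conditions on forms of degree
    [e], with the chosen [i + 1] coordinates of each point prescribed
    generically. Only [k - i] coordinates of each point remain, while each point
    imposes [N - k] conditions on [f]: this gives codimension
    [(N - k) - (k - i)] per point, on top of the condition [f|_P = 0].

    Dimensions are measured by algebraically independent functions: a chain of
    irreducible closed sets of length [m] yields [m] of them on its top member,
    and functions rational in [r] parameters admit at most [r] of them, by
    counting monomials. *)

Set Implicit Arguments.
Unset Strict Implicit.
Unset Printing Implicit Defensive.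

Import Order.TTheory GRing.Theory Num.Theory.
Local Open Scope ring_scope.

(** * Families of functions, linear and algebraic independence *)

(** The variety [C] varies with [f]. What is kept of it is finite data: a choice [iota] of
    coordinates and a choice [M] of monomials. For each such pair the count yields a relation, valid
    on all forms of that type, between functions that are independent on the top of a long chain.
    The product of these finitely many relations vanishes on the whole set, hence on its closure,
    and the irreducibility of the top of the chain gives the contradiction. No theorem on fibre
    dimensions enters the count. The free coordinates of the points are adjoined to the functions of
    [f] as further independent functions, and all of them are rational in the coordinates of the
    points on the plane and the coefficients of [f] that are not solved for. Points are vectors, not
    classes up to scaling, so each one carries [i + 1] free coordinates out of [k + 1]; the
    difference [k - i] is the same as for projective points. *)

Lemma fin_exists_bound (I : finType) (Q : I -> nat -> Prop) :
    (forall i m n, (m <= n)%N -> Q i m -> Q i n) ->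
    (forall i, exists n, Q i n) -> exists n, forall i, Q i n.
Proof.
move=> mono exQ.
have H (s : seq I) : exists n, forall i, i \in s -> Q i n.
  elim: s => [|i s [n IH]]; first by exists 0%N.
  have [m Qm] := exQ i; exists (maxn m n) => j; rewrite inE => /orP[/eqP->|js].
    exact: mono (leq_maxl _ _) Qm.
  exact: mono (leq_maxr _ _) (IH _ js).
by have [n Hn] := H (enum I); exists n => i; apply: Hn; rewrite mem_enum.
Qed.

(** The inequality behind both bounds on independent families: [K ^ r.+1] monomials cannot stay
    independent in a space whose dimension grows like [K ^ r]. *)
Lemma poly_growth (A B r : nat) :
  exists2 K, (0 < K)%N & (B * (A * K).+1 ^ r < K ^ r.+1)%N.
Proof.
(* Since [(A * K).+1 <= A.+1 * K], it suffices that [B * A.+1 ^ r < K]. *)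
exists (B * A.+1 ^ r).+1 => //.
set K := (B * A.+1 ^ r).+1.
have le1 : ((A * K).+1 <= A.+1 * K)%N by rewrite mulSn -add1n leq_add2r.
apply: (@leq_ltn_trans (B * (A.+1 * K) ^ r)%N).
  rewrite leq_mul2l; case: (r) => [|r']; first by rewrite leqnn orbT.
  by rewrite leq_exp2r // le1 orbT.
by rewrite expnMn mulnA expnS ltn_mul2r expn_gt0 /= ltnSn.
Qed.

Lemma big_injl (V : nmodType) (I J : finType) (phi : I -> J) (G : J -> V) :
    injective phi -> (forall j, j \notin codom phi -> G j = 0) ->
  \sum_j G j = \sum_i G (phi i).
Proof.
move=> inj G0; rewrite (bigID (mem (codom phi))) /= [X in _ + X]big1 ?addr0 //.
transitivity (\sum_(j in [set phi i | i in I]) G j).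
  by apply: eq_bigl => j; apply/codomP/imsetP => [[k ->]|[k _ ->]]; exists k.
by rewrite big_imset //= => ? ? _ _; exact: inj.
Qed.

Section Families.
Variables (F : fieldType) (T : Type).
Implicit Types (Z : T -> Prop) (u v : T -> F).

(** Functions live on all of [T] and are compared only on [Z]. This stands for working in the
    coordinate ring of [Z] without forming a quotient. *)
Definition vanish Z u := forall x, Z x -> u x = 0.

Definition lfree Z (I : finType) (A : I -> T -> F) :=
  forall c : I -> F, vanish Z (fun x => \sum_i c i * A i x) -> forall i, c i = 0.

Definition inspan Z (I : finType) (A : I -> T -> F) u :=
  exists c : I -> F, forall x, Z x -> u x = \sum_i c i * A i x.

Lemma inspan_gen Z (I : finType) (A : I -> T -> F) i : inspan Z A (A i).
Proof.
exists (fun j => (j == i)%:R) => x _.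
rewrite (bigD1 i) //= eqxx mul1r big1 ?addr0 // => j /negPf ->.
by rewrite mul0r.
Qed.

Lemma inspan_ext Z (I : finType) (A : I -> T -> F) u v :
  (forall x, Z x -> u x = v x) -> inspan Z A v -> inspan Z A u.
Proof. by move=> uv [c Hc]; exists c => x Zx; rewrite uv // Hc. Qed.

Lemma inspan_sum Z (I : finType) (A : I -> T -> F) (J : Type) (s : seq J)
    (P : pred J) (c : J -> F) (v : J -> T -> F) :
  (forall j, P j -> inspan Z A (v j)) ->
  inspan Z A (fun x => \sum_(j <- s | P j) c j * v j x).
Proof.
move=> Hv; elim: s => [|j s [b Hb]].
  exists (fun=> 0) => x _; rewrite big_nil big1 // => i _; exact: mul0r.
case Pj: (P j); last by exists b => x Zx; rewrite big_cons Pj Hb.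
have [a Ha] := Hv j Pj.
exists (fun i => c j * a i + b i) => x Zx.
rewrite big_cons Pj Ha // Hb // mulr_sumr -big_split /=.
by apply: eq_bigr => i _; rewrite mulrDl mulrA.
Qed.

Lemma lfree_inj Z (I J : finType) (A : I -> T -> F) (B : J -> T -> F)
    (phi : I -> J) :
    injective phi -> (forall i x, Z x -> A i x = B (phi i) x) ->
  lfree Z B -> lfree Z A.
Proof.
move=> inj AB freeB c Hc i.
pose b j := if [pick i | phi i == j] is Some i then c i else 0.
have bphi i' : b (phi i') = c i'.
  rewrite /b; case: pickP => [k /eqP/inj -> //|/(_ i')].
  by rewrite eqxx.
rewrite -bphi; apply: freeB => x Zx; rewrite -[RHS](Hc x Zx).
rewrite (big_injl inj) => [|j Nj]; last first.
  rewrite /b; case: pickP => [k /eqP kj|]; last by rewrite mul0r.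
  by rewrite -kj codom_f in Nj.
by apply: eq_bigr => k _; rewrite bphi AB.
Qed.

Lemma lfree_sub Z Z' (I : finType) (A : I -> T -> F) :
  (forall x, Z' x -> Z x) -> lfree Z' A -> lfree Z A.
Proof. by move=> sub fA c Hc; apply: fA => x /sub; apply: Hc. Qed.

Lemma not_lfree Z (I : finType) (A : I -> T -> F) : ~ lfree Z A ->
  exists c : I -> F, vanish Z (fun x => \sum_i c i * A i x) /\
                     exists i, c i != 0.
Proof.
move=> H; have [c Hc] := not_all_ex_not _ _ H.
have [{}Hc Hi] := imply_to_and _ _ Hc.
have [i /eqP ni] := not_all_ex_not _ _ Hi.
by exists c; split=> //; exists i.
Qed.

(** The factor [u], without zeros on [Z], serves to clear denominators: in [algfree_param] it is a
    power of the common denominator. *)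
Lemma lfree_card Z (I J : finType) (A : I -> T -> F) (Y : J -> T -> F) u :
    (forall x, Z x -> u x != 0) ->
    (forall i, inspan Z Y (fun x => u x * A i x)) ->
  lfree Z A -> (#|I| <= #|J|)%N.
Proof.
move=> unz spanA freeA; rewrite leqNgt; apply/negP => ltJI.
have [c Hc] : exists c : I -> J -> F,
    forall i x, Z x -> u x * A i x = \sum_j c i j * Y j x.
  have H (s : seq I) : exists c : I -> J -> F, forall i, i \in s ->
      forall x, Z x -> u x * A i x = \sum_j c i j * Y j x.
    elim: s => [|i s [c IH]]; first by exists (fun _ _ => 0).
    have [b Hb] := spanA i.
    exists (fun i' => if i' == i then b else c i') => i'; rewrite inE.
    by case: eqP => [-> _|_ /= /IH].
  by have [c Hc] := H (enum I); exists c => i; apply: Hc; rewrite mem_enum.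
pose M : 'M[F]_(#|I|, #|J|) := \matrix_(i, j) c (enum_val i) (enum_val j).
have : \rank (kermx M) != 0%N.
  by rewrite mxrank_ker -lt0n subn_gt0 (leq_ltn_trans (rank_leq_col _) ltJI).
rewrite mxrank_eq0 => /rowV0Pn[v /sub_kermxP vM0 /eqP]; apply.
apply/rowP => i; rewrite mxE.
have := freeA (fun k => v 0 (enum_rank k)) _ (enum_val i).
rewrite enum_valK; apply => x Zx.
apply: (mulfI (unz _ Zx)); rewrite mulr0 mulr_sumr.
under eq_bigr => k _ do rewrite mulrCA Hc // mulr_sumr.
rewrite exchange_big big1 //= => j _.
under eq_bigr => k _ do rewrite mulrA.
rewrite -mulr_suml.
have := congr1 (fun w : 'rV_#|J| => w 0 (enum_rank j)) vM0.
rewrite !mxE (reindex (fun k : 'I_#|I| => enum_val k)) /=; last first.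
  by exists enum_rank => k _; rewrite ?enum_valK ?enum_rankK.
under eq_bigr => k _ do rewrite mxE enum_rankK.
under [X in _ -> X * _ = _]eq_bigr => k _ do rewrite enum_valK.
by move=> ->; rewrite mul0r.
Qed.

Definition monof (J : finType) (y : J -> T -> F) (a : J -> nat) : T -> F :=
  fun x => \prod_j y j x ^+ a j.

(** Exponents are cut off at [K] to keep each family of monomials finite; letting [K] vary gives
    algebraic independence of the restrictions to [Z]. *)
Definition algfree Z (J : finType) (y : J -> T -> F) :=
  forall K, lfree Z (fun a : {ffun J -> 'I_K} => monof y (fun j => a j)).

Record funring (R : (T -> F) -> Prop) : Prop := FunRing {
  funring_cst : forall c, R (fun=> c);
  funring_add : forall u v, R u -> R v -> R (fun x => u x + v x);
  funring_mul : forall u v, R u -> R v -> R (fun x => u x * v x) }.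

(** The ideal of [Z] in [R] is prime or the unit ideal: [Z] may be empty, so nonemptiness is assumed
    separately where an empty product can occur. *)
Definition primeset (R : (T -> F) -> Prop) Z :=
  forall u v, R u -> R v -> vanish Z (fun x => u x * v x) ->
    vanish Z u \/ vanish Z v.

Section Ring.
Variables (R : (T -> F) -> Prop) (HR : funring R).

Lemma funring_sum (I : Type) (s : seq I) (P : pred I) (u : I -> T -> F) :
  (forall i, P i -> R (u i)) -> R (fun x => \sum_(i <- s | P i) u i x).
Proof.
move=> Ru; elim: s => [|i s IH].
  have -> : (fun x => \sum_(i <- [::] | P i) u i x) = (fun=> 0).
    by apply: functional_extensionality => x; rewrite big_nil.
  exact: funring_cst.
case Pi: (P i); last first.
  congr R: IH; apply: functional_extensionality => x.
  by rewrite big_cons Pi.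
congr R: (funring_add HR (Ru _ Pi) IH); apply: functional_extensionality => x.
by rewrite big_cons Pi.
Qed.

Lemma funring_prod (I : Type) (s : seq I) (P : pred I) (u : I -> T -> F) :
  (forall i, P i -> R (u i)) -> R (fun x => \prod_(i <- s | P i) u i x).
Proof.
move=> Ru; elim: s => [|i s IH].
  have -> : (fun x => \prod_(i <- [::] | P i) u i x) = (fun=> 1).
    by apply: functional_extensionality => x; rewrite big_nil.
  exact: funring_cst.
case Pi: (P i); last first.
  congr R: IH; apply: functional_extensionality => x.
  by rewrite big_cons Pi.
congr R: (funring_mul HR (Ru _ Pi) IH); apply: functional_extensionality => x.
by rewrite big_cons Pi.
Qed.

Lemma funring_exp u k : R u -> R (fun x => u x ^+ k).
Proof.
move=> Ru; elim: k => [|k IH]; first exact: (funring_cst HR 1).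
congr R: (funring_mul HR Ru IH); apply: functional_extensionality => x.
by rewrite exprS.
Qed.

Lemma funring_monof (J : finType) (y : J -> T -> F) a :
  (forall j, R (y j)) -> R (monof y a).
Proof. by move=> Ry; apply: funring_prod => j _; apply: funring_exp. Qed.

Lemma funring_comb (I : finType) (A : I -> T -> F) c :
  (forall i, R (A i)) -> R (fun x => \sum_i c i * A i x).
Proof.
move=> RA; apply: funring_sum => i _; apply: funring_mul => //.
exact: funring_cst.
Qed.

Lemma primeset_exp Z u k : primeset R Z -> R u ->
  (exists x, Z x) -> vanish Z (fun x => u x ^+ k) -> vanish Z u.
Proof.
move=> pZ Ru [z Zz]; elim: k => [|k IH] V.
  by have := V z Zz; rewrite expr0 => /eqP; rewrite oner_eq0.
have [] // := pZ u _ Ru (funring_exp k Ru) _ => x Zx.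
by rewrite -exprS V.
Qed.

Lemma primeset_prod Z (I : finType) (u : I -> T -> F) :
    primeset R Z -> (exists x, Z x) -> (forall i, R (u i)) ->
  vanish Z (fun x => \prod_i u i x) -> exists i, vanish Z (u i).
Proof.
move=> pZ [z Zz] Ru; rewrite /index_enum; elim: (Finite.enum _) => [|i s IH] V.
  by have := V z Zz; rewrite big_nil => /eqP; rewrite oner_eq0.
have [||V'|//] := pZ (u i) (fun x => \prod_(i <- s) u i x) (Ru i).
- by apply: funring_prod.
- by move=> x Zx; have := V x Zx; rewrite big_cons.
by exists i.
Qed.

(** In a relation on [Z], the lowest power of [h] can be cancelled because the ideal of [Z] is
    prime. Restricting the quotient to [Z'], where [h] vanishes, leaves only the terms of lowest
    power, and their coefficients are zero by independence on [Z']. *)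
Lemma lfree_adjoin Z Z' (I : finType) (A : I -> T -> F) h K :
    primeset R Z -> (forall x, Z' x -> Z x) -> (forall i, R (A i)) -> R h ->
    vanish Z' h -> ~ vanish Z h -> lfree Z' A ->
  lfree Z (fun (p : I * 'I_K) x => A p.1 x * h x ^+ p.2).
Proof.
move=> pZ sub RA Rh Vh NVh fA c Hc [i s].
have nemp : exists x, Z x.
  by apply: NNPP => N; apply: NVh => x Zx; case: N; exists x.
have [m] := ubnP (val s); elim: m i s => // m IH i s lts.
(* The relation divided by [h ^+ s], the coefficients of lower powers being zero by induction. *)
pose Q x := \sum_(p : I * 'I_K | (s <= p.2)%N) c p * (A p.1 x * h x ^+ (p.2 - s)).
have RQ : R Q.
  apply: funring_sum => p _; apply: (funring_mul HR (funring_cst HR _)).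
  exact: (funring_mul HR (RA _) (funring_exp _ Rh)).
have VhQ : vanish Z (fun x => h x ^+ s * Q x).
  move=> x Zx; rewrite -[RHS](Hc x Zx) [RHS](bigID (fun p : I * 'I_K => (s <= p.2)%N)) /=.
  rewrite [X in _ = _ + X]big1 ?addr0; last first.
    move=> [j t] /=; rewrite -ltnNge => ts; rewrite IH ?mul0r //.
    exact: leq_trans ts lts.
  rewrite mulr_sumr; apply: eq_bigr => -[j t] /= st.
  by rewrite -{2}(subnK st) exprD; rewrite !(mulrCA (h x ^+ s)) [h x ^+ s * _]mulrC.
have [/(primeset_exp pZ Rh nemp)//|VQ] := pZ _ _ (funring_exp s Rh) RQ VhQ.
apply: (fA (fun j => c (j, s))) => x Z'x.
rewrite -[RHS](VQ x (sub _ Z'x)) /Q.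
rewrite (bigID (fun p : I * 'I_K => p.2 == s)) /= [X in _ = _ + X]big1 ?addr0; last first.
  move=> [j t] /= /andP[st nts]; rewrite (Vh _ Z'x) expr0n subn_eq0 leqNgt.
  by rewrite ltn_neqAle st eq_sym val_eqE nts !mulr0.
rewrite (reindex_onto (fun j : I => (j, s)) (fun p => p.1)) /=; last first.
  by move=> [j t] /= /andP[_ /eqP->].
apply: eq_big => [j|j _]; first by rewrite leqnn !eqxx.
by rewrite subnn expr0 mulr1.
Qed.

(** Each strict inclusion contributes one independent function. [b] counts those available on the
    smallest set: none in the coefficient space, one on the cone over a projective set. *)
Lemma chain_algfree (Zs : nat -> T -> Prop) (h : nat -> T -> F) b m :
    (forall j, (j < m)%N -> primeset R (Zs j.+1)) ->
    (forall j, (j < m)%N -> forall x, Zs j x -> Zs j.+1 x) ->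
    (forall j, R (h j)) ->
    (forall j, (j < m)%N ->
       vanish (Zs j) (h (b + j)%N) /\ ~ vanish (Zs j.+1) (h (b + j)%N)) ->
    algfree (Zs 0%N) (fun j : 'I_b => h j) ->
  algfree (Zs m) (fun j : 'I_(b + m) => h j).
Proof.
elim: m => [|m IH] pZ sub Rh Hh f0 K.
  have e := addn0 b; set n := (b + 0)%N; rewrite -/n in e.
  by move: e; clearbody n => ->; apply: f0.
have fm : algfree (Zs m) (fun j : 'I_(b + m) => h j).
  by apply: IH => // j ltj; [apply: pZ|apply: sub|apply: Hh]; rewrite ltnS ltnW.
have [Vm NVm] := Hh m (ltnSn _).
have e := addnS b m; set n := (b + m.+1)%N; rewrite -/n in e.
rewrite {}e => {n}.
have fK := @lfree_adjoin _ _ _ _ (h (b + m)%N) K (pZ _ (ltnSn _)) (sub _ (ltnSn _))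
  (fun a => funring_monof _ (fun j : 'I_(b + m) => Rh j)) (Rh _) Vm NVm (fm K).
pose phi (a : {ffun 'I_(b + m).+1 -> 'I_K}) :=
  ([ffun j : 'I_(b + m) => a (widen_ord (leqnSn _) j)], a ord_max).
apply: lfree_inj (phi) _ _ fK.
  move=> a1 a2 [/ffunP e1 e2]; apply/ffunP => j.
  case: (unliftP ord_max j) => [l ->|-> //].
  have -> : lift ord_max l = widen_ord (leqnSn _) l.
    by apply: val_inj; exact: lift_max.
  by have := e1 l; rewrite !ffunE.
move=> a x _; rewrite /monof big_ord_recr /=; congr (_ * _).
by apply: eq_bigr => j _; rewrite ffunE.
Qed.

End Ring.

End Families.

(** * Standard monomials *)

Section StandardMonomials.
Variables (F : fieldType) (T : Type).
Implicit Types (Z : T -> Prop) (u v : T -> F).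

Lemma mevalEmonof n (y : 'I_n -> T -> F) (p : {mpoly F[n]}) x :
  p.@[fun j => y j x] = \sum_(m <- msupp p) p@_m * monof y m x.
Proof. exact: mevalE. Qed.

Lemma inspan_meval Z n (y : 'I_n -> T -> F) (J : finType) (Y : J -> T -> F)
    (p : {mpoly F[n]}) L :
    (forall m : 'X_{1..n}, (mdeg m <= L)%N -> inspan Z Y (monof y m)) ->
    (msize p <= L.+1)%N ->
  inspan Z Y (fun x => p.@[fun j => y j x]).
Proof.
move=> HL sp; apply: inspan_ext (fun x _ => mevalEmonof y p x) _.
apply: inspan_ext (inspan_sum (msupp p) (P := mem (msupp p)) (fun m => p@_m) _).
  by move=> x _; rewrite big_seq.
move=> m /= mp; apply: HL; rewrite -ltnS.
exact: leq_trans (msize_mdeg_lt mp) sp.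
Qed.

Lemma monofD n (y : 'I_n -> T -> F) (m1 m2 : 'X_{1..n}) x :
  monof y (m1 + m2)%MM x = monof y m1 x * monof y m2 x.
Proof.
by rewrite -big_split /=; apply: eq_bigr => j _; rewrite mnmDE exprD.
Qed.

(** A relation is solved for its leading monomial, so rewriting with it decreases the monomial
    order. The leading monomial involves only the variables in the image of [iota] because the whole
    relation does. *)
Lemma algdep_lead Z n r (y : 'I_n -> T -> F) (iota : 'I_r -> 'I_n) :
    injective iota -> ~ algfree Z (fun l => y (iota l)) ->
  exists m0 : 'X_{1..n}, (forall j, m0 j != 0%N -> exists l, j = iota l) /\
  exists (s : seq 'X_{1..n}) (c : 'X_{1..n} -> F),
    (forall m, m \in s -> (m < m0)%O) /\
    (forall x, Z x -> monof y m0 x = \sum_(m <- s) c m * monof y m x).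
Proof.
move=> inj_i /not_all_ex_not[K /not_lfree[c [Hc [a0 nz]]]].
pose push (a : {ffun 'I_r -> 'I_K}) : 'X_{1..n} :=
  [multinom (\sum_(l | iota l == j) a l)%N | j < n].
have pushE a l : push a (iota l) = a l.
  rewrite mnmE (big_pred1 l) // => k /=; exact: inj_eq.
have push_inj : injective push.
  by move=> a b /mnmP e; apply/ffunP => l; apply: val_inj; rewrite /= -!pushE e.
pose p : {mpoly F[n]} := \sum_a c a *: 'X_[push a].
have pE m : p@_m = \sum_a c a * (push a == m)%:R.
  by rewrite raddf_sum; apply: eq_bigr => a _; rewrite /= mcoeffZ mcoeffX.
have pnz : p != 0.
  apply/eqP => p0; case/eqP: nz; have := pE (push a0).
  rewrite p0 mcoeff0 (bigD1 a0) //= eqxx mulr1 big1 ?addr0 // => a na.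
  by rewrite (inj_eq push_inj) (negPf na) mulr0.
have mp := mlead_supp pnz.
exists (mlead p); split.
  move=> j; have [a /eqP <-] : exists a, push a == mlead p.
    apply/existsP; apply: contraLR mp; rewrite negb_exists => /forallP N.
    rewrite mcoeff_msupp negbK pE big1 // => a _.
    by rewrite (negPf (N a)) mulr0.
  rewrite mnmE => nz0; apply: NNPP => N; case/negP: nz0; apply/eqP.
  by rewrite big1 // => l /eqP il; case: N; exists l.
exists [seq m <- msupp p | m != mlead p], (fun m => - p@_m / p@_(mlead p)).
split=> [m|x Zx].
  by rewrite mem_filter lt_neqAle => /andP[-> /msupp_le_mlead].
have : p.@[fun j => y j x] = 0.
  rewrite raddf_sum -[RHS](Hc x Zx) /=; apply: eq_bigr => a _.
  rewrite mevalZ mevalX; congr (_ * _); rewrite /monof.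
  rewrite (partition_big iota xpredT) //=; apply: eq_bigr => j _.
  rewrite mnmE -prodrXr; apply: eq_bigr => l /eqP -> //.
rewrite mevalEmonof (bigD1_seq (mlead p)) ?msupp_uniq //= => /eqP.
rewrite addr_eq0 => /eqP e; have cnz : p@_(mlead p) != 0 by rewrite mleadc_eq0.
apply: (mulfI cnz); rewrite e big_filter mulr_sumr -sumrN.
apply: eq_bigr => m _; rewrite mulrA mulrCA mulfV // mulr1 mulNr //.
Qed.

(* Standard monomials: every monomial in which more than [r] exponents are
   large is divisible by the leading monomial of a relation, hence reducible;
   the irreducible monomials of degree at most [L] number [O(L^r)]. *)
Lemma algdep_growth Z n r (y : 'I_n.+1 -> T -> F) :
    (forall iota : 'I_r.+1 -> 'I_n.+1, injective iota ->
       ~ algfree Z (fun l => y (iota l))) ->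
  exists C, forall L, exists (J : finType) (Y : J -> T -> F),
    (#|J| <= C * L.+1 ^ r)%N /\
    forall m : 'X_{1..n.+1}, (mdeg m <= L)%N -> inspan Z Y (monof y m).
Proof.
move=> dep.
(* [w] will bound the degrees of the leading monomials uniformly over all sets of [r + 1]
   variables. *)
pose Q (I : {set 'I_n.+1}) w := (#|I| = r.+1)%N ->
  exists m0 : 'X_{1..n.+1}, [/\ (mdeg m0 <= w)%N, forall j, m0 j != 0%N -> j \in I &
  exists (s : seq 'X_{1..n.+1}) (c : 'X_{1..n.+1} -> F),
    (forall m, m \in s -> (m < m0)%O) /\
    (forall x, Z x -> monof y m0 x = \sum_(m <- s) c m * monof y m x)].
have [||w Hw] := @fin_exists_bound _ Q.
- move=> I m m' lem QI /QI[m0 [dm sup rel]]; exists m0; split=> //.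
  exact: leq_trans dm lem.
- move=> I; have [cI|nI] := eqVneq #|I| r.+1; last by exists 0%N => /eqP; rewrite (negPf nI).
  pose iota l := enum_val (cast_ord (esym cI) l).
  have inj_i : injective iota by move=> l1 l2 /enum_val_inj/cast_ord_inj.
  have [m0 [sup rel]] := algdep_lead inj_i (dep _ inj_i).
  exists (mdeg m0) => _; exists m0; split=> // j /sup[l ->]; exact: enum_valP.
(* The factors count the positions of at most [r] large exponents and the values of the small ones;
   the large exponents give [L.+1 ^ r]. *)
exists (n.+1 ^ r * w.+1 ^ n.+1)%N => L.
exists ({ffun 'I_r -> 'I_n.+1} * {ffun 'I_n.+1 -> 'I_w.+1} *
        {ffun 'I_r -> 'I_L.+1})%type.
exists (fun (q : {ffun 'I_r -> 'I_n.+1} * {ffun 'I_n.+1 -> 'I_w.+1} *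
                 {ffun 'I_r -> 'I_L.+1}) x =>
  monof y (fun j => q.1.2 j) x *
  monof (fun l : 'I_r => y (q.1.1 l)) (fun l => q.2 l) x).
split; first by rewrite !card_prod !card_ffun !card_ord.
elim/(@ltmwf n.+1) => m IH degm.
pose big := [set j | (w < m j)%N].
have [leb|gtb] := leqP #|big| r; last first.
  have [I sI cI] : exists2 I : {set 'I_n.+1}, I \subset big & #|I| = r.+1.
    have [s [us sz sub]] := card_geqP gtb.
    exists [set x in s]; last by rewrite cardsE (card_uniqP us).
    by apply/subsetP => j; rewrite inE => /sub.
  have [m0 [dm0 sup0 [s [c [lts rel]]]]] := Hw I cI.
  have lem : (m0 <= m)%MM.
    apply/mnm_lepP => j; have [->//|nz] := eqVneq (m0 j) 0%N.
    have := subsetP sI _ (sup0 _ nz); rewrite inE => ltw.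
    apply: leq_trans (ltnW ltw); apply: leq_trans dm0.
    by rewrite mdegE (bigD1 j) //= leq_addr.
  apply: (@inspan_ext _ _ _ _ _ _ (fun x => \sum_(m1 <- s | m1 \in s) c m1 * monof y (m1 + (m - m0))%MM x)).
    move=> x Zx; rewrite -{1}(submK lem) addmC monofD rel // -big_seq mulr_suml.
    by apply: eq_bigr => m1 _; rewrite monofD mulrA.
  apply: inspan_sum => m1 /lts lt1.
  have lt2 : ((m1 + (m - m0))%MM < m)%O.
    by rewrite -{2}(submK lem) addmC ltmc_add2r.
  apply: IH => //; apply: leq_trans degm; exact: lemc_mdeg (ltW lt2).
(* The list of large positions is padded with [ord0]; [t] puts exponent 0 on the padding. *)
pose sigma := [ffun l : 'I_r => nth ord0 (enum big) l].
pose v := [ffun j : 'I_n.+1 => inord (if j \in big then 0%N else m j) : 'I_w.+1].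
pose t := [ffun l : 'I_r => inord (if (l < #|big|)%N then m (sigma l) else 0%N) : 'I_L.+1].
apply: inspan_ext (inspan_gen _ _ (sigma, v, t)) => x _ /=.
rewrite {1}/monof (bigID (mem big)) /= mulrC; congr (_ * _).
  rewrite /monof big_mkcond; apply: eq_bigr => j _; rewrite ffunE.
  rewrite /big inE; case: ltnP => /= le; rewrite inordK ?expr0 //.
transitivity (\prod_(j <- enum big) y j x ^+ m j).
  by rewrite big_enum.
rewrite (big_nth ord0) -cardE big_mkord /monof.
rewrite (big_ord_widen_cond _ xpredT (fun l => y (nth ord0 (enum big) l) x ^+ m (nth ord0 (enum big) l)) leb).
rewrite big_mkcond; apply: eq_bigr => l _; rewrite !ffunE /=.
case: ifP => le; rewrite inordK ?expr0 //.
rewrite ltnS; apply: leq_trans degm.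
by rewrite mdegE (bigD1 (nth ord0 (enum big) l)) //= leq_addr.
Qed.

Lemma msizeM_deg n (p q : {mpoly F[n]}) a b :
  (msize p <= a.+1)%N -> (msize q <= b.+1)%N -> (msize (p * q) <= (a + b).+1)%N.
Proof.
have [->|nzp] := eqVneq p 0; first by rewrite mul0r msize0.
have [->|nzq] := eqVneq q 0; first by rewrite mulr0 msize0.
rewrite msizeM //; move: (msize p) (msize q) => s t; lia.
Qed.

Lemma msizeX_deg n (p : {mpoly F[n]}) d k :
  (msize p <= d.+1)%N -> (msize (p ^+ k) <= (k * d).+1)%N.
Proof.
move=> sp; elim: k => [|k IH]; first by rewrite expr0 msize1.
by rewrite exprS mulSn; apply: msizeM_deg.
Qed.

Lemma msize_prod_deg n (I : finType) (p : I -> {mpoly F[n]}) (d : nat) :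
  (forall i, (msize (p i) <= d.+1)%N) -> (msize (\prod_i p i) <= (#|I| * d).+1)%N.
Proof.
move=> sp; rewrite cardE /index_enum -enumT; elim: (enum I) => [|i s IH].
  by rewrite big_nil msize1.
by rewrite big_cons mulSn; apply: msizeM_deg.
Qed.

(** A growth count in place of the exchange property of transcendence bases. If every [r + 1]
    coordinates were dependent, polynomials of degree [L] would span only [O(L^r)] dimensions, too
    few for the [K ^ r.+1] monomials in [h], which have degree at most a constant times [K]. *)
Lemma algfree_coordinates Z n r (y : 'I_n.+1 -> T -> F) (h : 'I_r.+1 -> T -> F) :
    (forall j, exists p : {mpoly F[n.+1]}, forall x, Z x -> h j x = p.@[fun l => y l x]) ->
    algfree Z h ->
  exists2 iota : 'I_r.+1 -> 'I_n.+1, injective iota &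
    algfree Z (fun l => y (iota l)).
Proof.
move=> hp freeh; apply: NNPP => N.
have [|C growth] := @algdep_growth Z n r y.
  by move=> iota inj fi; apply: N; exists iota.
have [d Hd] : exists d, forall j, exists2 p : {mpoly F[n.+1]}, (msize p <= d.+1)%N &
    forall x, Z x -> h j x = p.@[fun l => y l x].
  apply: fin_exists_bound => [j m m' lem [p sp Hp]|j].
    by exists p => //; apply: leq_trans sp _.
  by have [p Hp] := hp j; exists (msize p); exists p.
have [K Kpos HK] := poly_growth (r.+1 * d) C r.
have [J [Y [cJ HY]]] := growth (r.+1 * d * K)%N.
suff : (#|{ffun 'I_r.+1 -> 'I_K}| <= #|J|)%N.
  by rewrite card_ffun !card_ord leqNgt (leq_ltn_trans cJ HK).
apply: (lfree_card (u := fun=> 1)) (freeh K) => [x _|a]; first exact: oner_neq0.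
have [p sp Hp] := fin_all_exists2 Hd.
apply: (@inspan_ext _ _ _ _ _ _ (fun x => (\prod_j p j ^+ a j).@[fun l => y l x])).
  move=> x Zx; rewrite mul1r rmorph_prod; apply: eq_bigr => j _.
  by rewrite rmorphXn /= Hp.
apply: inspan_meval HY _.
have -> : (r.+1 * d * K = #|'I_r.+1| * (K * d))%N by rewrite card_ord; lia.
apply: msize_prod_deg => j; apply: leq_trans (msizeX_deg _ (sp j)) _.
by rewrite ltnS leq_mul2r ltnW ?orbT.
Qed.

End StandardMonomials.

(** * Hilbert functions *)

Lemma subspace_mx (F : fieldType) n (Q : 'rV[F]_n -> Prop) :
    Q 0 -> (forall a u v, Q u -> Q v -> Q (a *: u + v)) ->
  exists M : 'M[F]_n, forall v, Q v <-> (v <= M)%MS.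
Proof.
move=> Q0 Qlin.
have Qsub (M : 'M[F]_n) : (forall i, Q (row i M)) -> forall v, (v <= M)%MS -> Q v.
  move=> QM v /submxP[w ->]; rewrite mulmx_sum_row.
  elim/big_rec: _ => [//|i u _ Qu]; exact: Qlin.
have H s (M : 'M[F]_n) : (forall v, (v <= M)%MS -> Q v) -> (n - \rank M <= s)%N ->
    exists M : 'M[F]_n, forall v, Q v <-> (v <= M)%MS.
  elim: s M => [|s IH] M QM rM.
    exists M => v; split=> [_|]; last exact: QM.
    apply: submx_full; rewrite /row_full eqn_leq rank_leq_col /=; move: rM; lia.
  have [HM|/not_all_ex_not[v Hv]] := classic (forall v, Q v -> (v <= M)%MS).
    by exists M => v; split; [exact: HM|exact: QM].
  have [Qv /negP nv] := imply_to_and _ _ Hv.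
  apply: (IH (M + v)%MS).
    move=> u /sub_addsmxP[[w1 w2] /= ->].
    rewrite [w2]mx11_scalar mul_scalar_mx addrC; apply: Qlin => //.
    by apply: QM; exact: submxMl.
  have ltr : (\rank M < \rank (M + v)%MS)%N.
    have : (M < M + v)%MS by rewrite /ltmx addsmxSl addsmx_sub submx_refl.
    by rewrite ltmxErank => /andP[].
  by move: ltr rM; lia.
apply: (H n 0) => [v|]; last exact: leq_subr.
by rewrite submx0 => /eqP->.
Qed.

Section Combinations.
Variables (F : fieldType) (T : Type).
Implicit Types (Z : T -> Prop).

Definition combof p (A : 'I_p -> T -> F) (v : 'rV[F]_p) : T -> F :=
  fun x => \sum_j v 0 j * A j x.

Lemma combof_mul m p (A : 'I_p -> T -> F) (v : 'rV[F]_m) (M : 'M[F]_(m, p)) x :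
  combof A (v *m M) x = combof (fun l => combof A (row l M)) v x.
Proof.
rewrite /combof; under eq_bigr do rewrite mxE mulr_suml.
rewrite exchange_big; apply: eq_bigr => l _; rewrite mulr_sumr.
by apply: eq_bigr => j _; rewrite mxE mulrA.
Qed.

Lemma combof_delta p (A : 'I_p -> T -> F) j x : combof A (delta_mx 0 j) x = A j x.
Proof.
rewrite /combof (bigD1 j) //= mxE !eqxx mul1r big1 ?addr0 // => l nl.
by rewrite mxE (negPf nl) andbF mul0r.
Qed.

Lemma combofD p (A : 'I_p -> T -> F) a (v w : 'rV[F]_p) x :
  combof A (a *: v + w) x = a * combof A v x + combof A w x.
Proof.
rewrite /combof mulr_sumr -big_split; apply: eq_bigr => j _.
by rewrite !mxE mulrDl mulrA.
Qed.

Lemma lfreeV Z p (A : 'I_p -> T -> F) :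
  lfree Z A <-> forall v : 'rV[F]_p, vanish Z (combof A v) -> v = 0.
Proof.
split=> [fA v Hv|H c Hc i]; first by apply/rowP => j; rewrite mxE (fA _ Hv).
have := H (\row_j c j); move/(_ _)/rowP/(_ i); rewrite !mxE; apply=> x Zx.
by rewrite -[RHS](Hc x Zx); apply: eq_bigr => j _; rewrite mxE.
Qed.

Lemma relation_mx Z p (A : 'I_p -> T -> F) :
  exists M : 'M[F]_p, forall v : 'rV[F]_p, vanish Z (combof A v) <-> (v <= M)%MS.
Proof.
apply: subspace_mx => [x Zx|a v w Vv Vw x Zx].
  by rewrite /combof big1 // => j _; rewrite mxE mul0r.
by rewrite combofD Vv // Vw // mulr0 addr0.
Qed.

Lemma lfree_neq0 Z (I : finType) (A : I -> T -> F) i : lfree Z A -> ~ vanish Z (A i).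
Proof.
move=> fA V; have := fA (fun j => (j == i)%:R) _ i; rewrite eqxx.
move/(_ _)/eqP; rewrite oner_eq0 => H; apply: notF; apply: H => x Zx.
rewrite (bigD1 i) //= (V x Zx) mulr0 add0r big1 // => j /negPf->.
by rewrite mul0r.
Qed.

Lemma lfree_injective Z (I : finType) (A : I -> T -> F) i j :
  lfree Z A -> A i = A j -> i = j.
Proof.
move=> fA Aij; apply/eqP; apply: contraT => nij.
have := fA (fun l => (l == i)%:R - (l == j)%:R) _ i; rewrite eqxx (negPf nij) subr0.
move/(_ _)/eqP; rewrite oner_eq0 => H; apply: H => x _.
rewrite (bigD1 i) //= (bigD1 j) 1?eq_sym //= !eqxx [j == i]eq_sym (negPf nij).
rewrite big1 => [|l /andP[/negPf-> /negPf->]]; last by rewrite subrr mul0r.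
by rewrite Aij subr0 sub0r mul1r mulN1r addr0 subrr.
Qed.

(** The target of the products in [hopf_dim] is a predicate, not the span of a given family, so that
    the induction can pass from [W] to its multiples by a function. *)
Record linspace Z (W : (T -> F) -> Prop) : Prop := LinSpace {
  linspace0 : W (fun=> 0);
  linspaceD : forall a (u v : T -> F), W u -> W v -> W (fun x => a * u x + v x);
  linspace_ext : forall (u v : T -> F), (forall x, Z x -> u x = v x) -> W u -> W v }.

Lemma linspace_sum Z W (I : Type) (s : seq I) (c : I -> F) (u : I -> T -> F) :
  linspace Z W -> (forall i, W (u i)) -> W (fun x => \sum_(i <- s) c i * u i x).
Proof.
move=> HW Wu; elim: s => [|i s IH].
  by apply: linspace_ext HW _ _ _ (linspace0 HW) => x _; rewrite big_nil.
apply: linspace_ext HW _ _ _ (linspaceD HW (c i) (Wu i) IH) => x _.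
by rewrite big_cons.
Qed.

Lemma linspace_inspan Z (I : finType) (A : I -> T -> F) : linspace Z (inspan Z A).
Proof.
split=> [|a u v [c Hc] [b Hb]|u v uv]; last by apply: inspan_ext => x Zx; rewrite uv.
  by exists (fun=> 0) => x _; rewrite big1 // => i _; rewrite mul0r.
exists (fun i => a * c i + b i) => x Zx; rewrite Hc // Hb // mulr_sumr -big_split.
by apply: eq_bigr => i _; rewrite mulrDl mulrA.
Qed.

(** Turns a dimension bound into a choice of members of [A]. It is applied to monomials, which later
    index the coefficients to be solved for. *)
Lemma lfree_subfamily Z (I : finType) (A : I -> T -> F) n (G : 'I_n -> T -> F) :
    (forall l, inspan Z A (G l)) -> lfree Z G ->
  exists2 s : 'I_n -> I, injective s & lfree Z (fun l => A (s l)).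
Proof.
move=> spanG freeG.
pose B (j : 'I_#|I|) := A (enum_val j).
have [K HK] := relation_mx Z B.
have [g Hg] := fin_all_exists (spanG : forall l, exists c : I -> F,
  forall x, Z x -> G l x = \sum_i c i * A i x).
pose M : 'M[F]_(n, #|I|) := \matrix_(l, j) g l (enum_val j).
have HM v x : Z x -> combof B (v *m M) x = combof G v x.
  move=> Zx; rewrite combof_mul; apply: eq_bigr => l _; congr (_ * _).
  rewrite Hg // (reindex (@enum_val I I)) /=; last first.
    by exists enum_rank => k _; rewrite ?enum_valK ?enum_rankK.
  by apply: eq_bigr => j _; rewrite !mxE.
(* Multiplication by [Q] is the quotient by the relations on [Z], so independence on [Z] becomes
   freeness of rows. *)
pose Q := cokermx K.
have freeMQ : row_free (M *m Q).
  rewrite -kermx_eq0; apply/rowV0P => v /sub_kermxP; rewrite mulmxA => vMQ.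
  have : (v *m M <= K)%MS by rewrite submxE; apply/eqP.
  move/HK => V; apply: (proj1 (lfreeV Z G) freeG) => x Zx.
  by rewrite -HM // V.
have rkQ : (n <= \rank Q)%N.
  by rewrite -(eqP freeMQ) mxrankM_maxr.
pose f (l : 'I_n) := maxrankfun Q (widen_ord rkQ l).
exists (fun l => enum_val (f l)).
  by move=> l1 l2 /enum_val_inj /maxrankfun_inj /(congr1 val) /= /val_inj.
have fr := maxrowsub_free Q.
apply: (@lfree_inj _ _ _ _ 'I_(\rank Q) _ (fun l => B (maxrankfun Q l)) (widen_ord rkQ)) => //.
  by move=> l1 l2 /(congr1 val) /= /val_inj.
apply/lfreeV => v V.
have : (v *m rowsub (maxrankfun Q) 1%:M <= K)%MS.
  apply/HK => x Zx; rewrite combof_mul -[RHS](V x Zx); apply: eq_bigr => l _.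
  congr (_ * _); rewrite -[RHS]combof_delta; congr (combof _ _ _).
  by apply/rowP => j; rewrite !mxE eqxx eq_sym.
rewrite submxE -mulmxA mul_rowsub_mx mul1mx => /eqP e.
by apply: (row_free_inj fr); rewrite mul0mx.
Qed.

End Combinations.

(** * Hopf's inequality for products of spaces of functions *)

Section Hopf.
Variables (F : numClosedFieldType) (T : Type) (R : (T -> F) -> Prop) (Z : T -> Prop).
Hypotheses (HR : funring R) (pZ : primeset R Z).

Lemma funring_combof p (A : 'I_p -> T -> F) v :
  (forall i, R (A i)) -> R (combof A v).
Proof. by move=> RA; apply: funring_comb. Qed.

(** Otherwise multiplication by [B j1 / B j0] would preserve the span of [A]. An eigenvector [v]
    with eigenvalue [a], which exists over an algebraically closed field, would give
    [combof A v * (B j1 - a B j0) = 0] on [Z], against primality and the independence of [A] and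
    [B]. *)
Lemma eigen_escape p q (A : 'I_p -> T -> F) (B : 'I_q -> T -> F) j0 j1 :
    (0 < p)%N -> j0 != j1 -> (forall i, R (A i)) -> (forall j, R (B j)) ->
    lfree Z A -> lfree Z B ->
  exists i, ~ exists c : 'I_p -> F, forall x, Z x ->
    A i x * B j1 x = \sum_l c l * (B j0 x * A l x).
Proof.
move=> p0 nj RA RB fA fB; apply: NNPP => N.
have /fin_all_exists[c Hc] (i : 'I_p) : exists c : 'I_p -> F, forall x, Z x ->
    A i x * B j1 x = \sum_l c l * (B j0 x * A l x).
  apply: NNPP => Ni; apply: N.
  by exists i => -[c Hc]; apply: Ni; exists c.
have [a /eigenvalueP[v vM nzv]] := eigenvalue_closed (\matrix_(i, l) c i l) p0.
have [] := @pZ (combof A v) (fun x => B j1 x + (- a) * B j0 x).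
- exact: funring_combof.
- by apply: (funring_add HR) => //; apply: (funring_mul HR) => //; apply: funring_cst.
- move=> x Zx; rewrite mulrDr mulr_suml.
  under eq_bigr do rewrite -mulrA Hc // mulr_sumr.
  rewrite exchange_big /=.
  have -> : \sum_l \sum_i v 0 i * (c i l * (B j0 x * A l x)) =
            a * combof A v x * B j0 x.
    rewrite /combof mulr_sumr mulr_suml; apply: eq_bigr => l _; rewrite mulrA.
    have := congr1 (fun w : 'rV_p => w 0 l) vM; rewrite !mxE => <-.
    rewrite !mulr_suml; apply: eq_bigr => i _; rewrite mxE.
    by rewrite !mulrA (mulrAC _ (B j0 x)).
  by rewrite mulNr mulrN mulrCA mulrA subrr.
- by move/(proj1 (lfreeV Z A) fA)/eqP; rewrite (negPf nzv).
move=> V; have := fB (fun j => if j == j1 then 1 else if j == j0 then - a else 0) _ j1.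
rewrite eqxx; move/(_ _)/eqP; rewrite oner_eq0 => H; apply: notF; apply: H => x Zx.
rewrite -[RHS](V x Zx) (bigD1 j1) //= eqxx mul1r; congr (_ + _).
rewrite (bigD1 j0) //= eqxx (negPf nj) big1 ?addr0 // => j /andP[/negPf-> /negPf->].
by rewrite mul0r.
Qed.

(* Dyson's e-transform with e = a / b: replacing (A, B) by
   (b A + a B, {beta in B | a beta in b A}) preserves the sum of the dimensions,
   keeps the products inside b W, and shrinks B unless B is a line. *)
Lemma hopf_dim q p (A : 'I_p -> T -> F) (B : 'I_q -> T -> F) W :
    (0 < p)%N -> (0 < q)%N -> (forall i, R (A i)) -> (forall j, R (B j)) ->
    lfree Z A -> lfree Z B -> linspace Z W ->
    (forall i j, W (fun x => A i x * B j x)) ->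
  exists2 n, n.+1 = (p + q)%N & exists2 G : 'I_n -> T -> F, lfree Z G & forall l, W (G l).
Proof.
elim/ltn_ind: q p A B W => q IH p A B W p0 q0 RA RB fA fB HW WAB.
pose j0 : 'I_q := Ordinal q0.
have [q1|q1] := leqP q 1.
  exists p; first lia.
  exists (fun i x => A i x * B j0 x) => //; apply/lfreeV => v V.
  have [|||VA|VB] := pZ (u := combof A v) (v := B j0).
  - exact: funring_combof.
  - exact: RB.
  - move=> x Zx; rewrite -[RHS](V x Zx) mulr_suml.
    by apply: eq_bigr => i _; rewrite mulrA.
  - exact: (proj1 (lfreeV Z A) fA).
  by case: (lfree_neq0 fB VB).
pose j1 : 'I_q := Ordinal q1.
have [i0 Ni0] := @eigen_escape p q A B j0 j1 p0 isT RA RB fA fB.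
pose a := A i0; pose b := B j0.
pose D (l : 'I_(p + q)) : T -> F := match split l with
  | inl i => fun x => b x * A i x | inr j => fun x => a x * B j x end.
have combD v x : combof D v x = b x * combof A (lsubmx v) x + a x * combof B (rsubmx v) x.
  rewrite /combof big_split_ord /= !mulr_sumr; congr (_ + _); apply: eq_bigr => l _.
    by rewrite /D [split _](unsplitK (inl _ l)) mxE mulrCA.
  by rewrite /D [split _](unsplitK (inr _ l)) mxE mulrCA.
have cancelb u : R u -> vanish Z (fun x => b x * u x) -> vanish Z u.
  by move=> Ru /(pZ (RB j0) Ru)[/(lfree_neq0 fB)|].
have [K HK] := relation_mx Z D.
(* [K] consists of the pairs [(alpha, beta)] with [b alpha + a beta = 0]. Its projection to [beta]
   is injective, and the image is the new, smaller [B]. *)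
have relA (v : 'rV_(p + q)) : (v <= K)%MS -> rsubmx v = 0 -> v = 0.
  move=> /HK V r0; rewrite -[v]hsubmxK r0.
  have -> : lsubmx v = 0; last by rewrite row_mx0.
  apply: (proj1 (lfreeV Z A) fA); apply: cancelb; first exact: funring_combof.
  move=> x Zx; rewrite -[RHS](V x Zx) combD r0 [X in _ = _ + _ * X]big1 ?mulr0 ?addr0 //.
  by move=> j _; rewrite mxE mul0r.
pose q' := \rank K.
(* The pair [(a, - b)] is a relation. *)
have q'0 : (0 < q')%N.
  rewrite /q' lt0n mxrank_eq0; apply/eqP => K0.
  have : ((row_mx (delta_mx 0 i0) (- delta_mx 0 j0) : 'rV[F]_(p + q)) <= K)%MS.
    apply/HK => x Zx; rewrite combD row_mxKl row_mxKr combof_delta.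
    have -> : combof B (- delta_mx 0 j0) x = - B j0 x.
      rewrite -[RHS]mulN1r -combof_delta -[RHS]addr0.
      have -> : - delta_mx 0 j0 = (-1) *: delta_mx 0 j0 + 0 :> 'rV[F]_q.
        by rewrite scaleN1r addr0.
      rewrite combofD; congr (_ + _); rewrite /combof big1 // => j _.
      by rewrite mxE mul0r.
    by rewrite mulrN mulrC subrr.
  rewrite K0 submx0 => /eqP/(congr1 (fun v : 'rV_(p + q) => lsubmx v 0 i0)).
  by rewrite row_mxKl !mxE !eqxx => /eqP; rewrite oner_eq0.
pose KB := row_base K.
pose B' (l : 'I_q') : T -> F := combof B (rsubmx (row l KB)).
have rKB (v : 'rV_q') : rsubmx (v *m KB) = v *m rsubmx KB by rewrite -mulmx_rsub.
have inKB (v : 'rV_q') : (v *m KB <= K)%MS by rewrite (submx_trans (submxMl _ _)) ?eq_row_base.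
have freerKB (v : 'rV_q') : v *m rsubmx KB = 0 -> v = 0.
  move=> e; have e0 := relA _ (inKB v) (etrans (rKB v) e); apply: (row_free_inj (row_base_free K)).
  by rewrite e0 mul0mx.
(* Equality would put [B j1] into the new [B], hence [A i0 * B j1] into [B j0] times the span of
   [A], which the choice of [i0] excludes. *)
have q'q : (q' < q)%N.
  have fr : row_free (rsubmx KB).
    by rewrite -kermx_eq0; apply/rowV0P => v /sub_kermxP/freerKB.
  have leq' : (q' <= q)%N by rewrite /q' -(eqP fr) rank_leq_col.
  rewrite ltn_neqAle leq' andbT; apply/eqP => eq'.
  have full : row_full (rsubmx KB) by rewrite /row_full (eqP fr) -/q' eq'.
  have /submxP[v Hv] := submx_full (delta_mx 0 j1 : 'rV_q) full.
  have V := proj2 (HK _) (inKB v); apply: Ni0.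
  exists (fun l => - lsubmx (v *m KB) 0 l) => x Zx.
  have := V x Zx; rewrite combD rKB -Hv combof_delta => /eqP.
  rewrite addrC addr_eq0 /a => /eqP->; rewrite /combof mulr_sumr -sumrN.
  by apply: eq_bigr => l _; rewrite mulNr mulrCA.
have fB' : lfree Z B'.
  apply/lfreeV => v V; apply: freerKB; apply: (proj1 (lfreeV Z B) fB) => x Zx.
  rewrite combof_mul -[RHS](V x Zx); apply: eq_bigr => l _; congr (_ * _).
  by rewrite /B'; congr (combof _ _ _); apply/rowP => j; rewrite !mxE.
(* A complement of the relations gives a basis of [b A + a B], of size [p + q - q']. *)
pose CB := row_base (K^C)%MS.
pose A' (l : 'I_(\rank (K^C)%MS)) : T -> F := combof D (row l CB).
have RD l : R (D l).
  by rewrite /D; case: split => t; apply: (funring_mul HR); rewrite /a /b.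
have fA' : lfree Z A'.
  apply/lfreeV => v V; apply: (row_free_inj (row_base_free (K^C)%MS)).
  rewrite mul0mx; apply/eqP; rewrite -submx0 -(capmx_compl K) sub_capmx.
  apply/andP; split; last by rewrite (submx_trans (submxMl _ _)) ?eq_row_base.
  by apply/HK => x Zx; rewrite combof_mul V.
have rC : \rank (K^C)%MS = (p + q - q')%N by rewrite mxrank_compl.
pose W' u := exists2 w, W w & forall x, Z x -> u x = b x * w x.
have HW' : linspace Z W'.
  split=> [|c u v [w1 W1 H1] [w2 W2 H2]|u v uv [w Ww Hw]].
  - by exists (fun=> 0) => [|x _]; [exact: linspace0 HW|rewrite mulr0].
  - exists (fun x => c * w1 x + w2 x); first exact: linspaceD HW _ _ _ W1 W2.
    by move=> x Zx; rewrite H1 // H2 // mulrDr mulrCA.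
  by exists w => // x Zx; rewrite -uv // Hw.
have WcA v j : W (fun x => combof A v x * B j x).
  apply: linspace_ext HW _ _ _ (linspace_sum (index_enum _) (v 0) HW (fun i => WAB i j)).
  by move=> x _; rewrite /combof mulr_suml; apply: eq_bigr => i _; rewrite mulrA.
have WcB i v : W (fun x => A i x * combof B v x).
  apply: linspace_ext HW _ _ _ (linspace_sum (index_enum _) (v 0) HW (WAB i)).
  by move=> x _; rewrite /combof mulr_sumr; apply: eq_bigr => j _; rewrite mulrCA.
have WAB' i j : W' (fun x => A' i x * B' j x).
  have WD l : W' (fun x => D l x * B' j x).
    rewrite /D; case: (split l) => t.
      exists (fun x => A t x * B' j x) => [|x _]; [exact: WcB|by rewrite mulrA].
    have rel : vanish Z (combof D (row j KB)).
      by apply/HK; rewrite (submx_trans (row_sub _ _)) ?eq_row_base.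
    exists (fun x => combof A (- lsubmx (row j KB)) x * B t x) => [|x Zx]; first exact: WcA.
    have := rel x Zx; rewrite combD addrC => /eqP; rewrite addr_eq0 => /eqP e.
    have -> : combof A (- lsubmx (row j KB)) x = - combof A (lsubmx (row j KB)) x.
      by rewrite /combof -sumrN; apply: eq_bigr => l' _; rewrite mxE mulNr.
    by rewrite mulrA mulrN -e -/(B' j) mulrAC.
  apply: linspace_ext HW' _ _ _ (linspace_sum (index_enum _) (row i CB 0) HW' WD).
  by move=> x _; rewrite /A' /combof mulr_suml; apply: eq_bigr => l _; rewrite mulrA.
have [|||n en [G fG WG]] := IH q' q'q _ A' B' W' _ q'0 _ _ fA' fB' HW' WAB'.
- by rewrite rC; lia.
- by move=> i; apply: funring_combof.
- by move=> i; apply: funring_combof.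
exists n; first by rewrite en rC; lia.
have [G' WG' HG'] := fin_all_exists2 WG.
exists G' => //; apply/lfreeV => v V; apply: (proj1 (lfreeV Z G) fG) => x Zx.
rewrite /combof; under eq_bigr do rewrite HG' // mulrCA.
by rewrite -mulr_sumr -/(combof G' v x) V // mulr0.
Qed.

End Hopf.

(** * Monomials of fixed degree and the linear bound on Hilbert functions *)

Section HomogeneousMonomials.
Variables (F : numClosedFieldType) (T : Type).

Definition homon n e : finType := {m : 'X_{1..n < e.+1} | mdeg m == e}.

Definition mnm_of n e (m : homon n e) : 'X_{1..n} := bmnm (val m).

Lemma mnm_of_inj n e : injective (@mnm_of n e).
Proof. by move=> m1 m2 /val_inj/val_inj. Qed.

Lemma mdeg_mnm_of n e (m : homon n e) : mdeg (mnm_of m) = e.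
Proof. exact: eqP (valP m). Qed.

Lemma homon_subproof n e (m : 'X_{1..n}) : mdeg m = e -> (mdeg m < e.+1)%N.
Proof. by move=> ->. Qed.

Definition to_homon n e (m : 'X_{1..n}) (dm : mdeg m = e) : homon n e :=
  exist _ (BMultinom (homon_subproof dm)) (introT eqP dm).

Lemma to_homonK n e (m : 'X_{1..n}) (dm : mdeg m = e) : mnm_of (to_homon dm) = m.
Proof. by []. Qed.

Lemma homonP n e (m : 'X_{1..n}) : mdeg m = e -> exists m' : homon n e, mnm_of m' = m.
Proof. by move=> dm; exists (to_homon dm). Qed.

Lemma card_homon n e : #|homon n.+1 e| = 'C(e + n, e).
Proof.
rewrite -size_basis cardE -(size_map (@mnm_of n.+1 e)); apply/perm_size/uniq_perm.
- by rewrite map_inj_uniq ?enum_uniq //; exact: mnm_of_inj.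
- exact: uniq_basis.
move=> m; rewrite -basis_cover; apply/mapP/eqP => [[m' _ ->]|/homonP[m' <-]].
  exact: mdeg_mnm_of.
by exists m'; rewrite ?mem_enum.
Qed.

Variables (R : (T -> F) -> Prop) (Z : T -> Prop).
Hypotheses (HR : funring R) (pZ : primeset R Z).

(* [h(e) >= e k + 1] for the Hilbert function of a nondegenerate irreducible
   variety in [P^k]. *)
Lemma hilbert_linear k e (y : 'I_k.+1 -> T -> F) :
    (exists x, Z x) -> (forall j, R (y j)) -> lfree Z y ->
  exists2 G : 'I_(e * k).+1 -> T -> F, lfree Z G &
    forall l, inspan Z (fun m : homon k.+1 e => monof y (mnm_of m)) (G l).
Proof.
move=> [z Zz] Ry fy; elim: e => [|e [G fG WG]].
  exists (fun _ _ => 1) => [c /(_ z Zz)|l].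
    by rewrite big_ord1 mulr1 => c0 i; rewrite (ord1 i).
  have [m em] := homonP (@mdeg0 k.+1).
  apply: inspan_ext (inspan_gen _ _ m) => x _; rewrite em /monof big1 // => j _.
  by rewrite mnm0E.
have [c Hc] := fin_all_exists (WG : forall l, exists c : homon k.+1 e -> F,
  forall x, Z x -> G l x = \sum_m c m * monof y (mnm_of m) x).
(* [G l] agrees with a form only on [Z]; [hopf_dim] needs functions that belong to [R]. *)
pose G' l x := \sum_m c l m * monof y (mnm_of m) x.
have fG' : lfree Z G'.
  move=> a Ha; apply: fG => x Zx; rewrite -[RHS](Ha x Zx).
  by apply: eq_bigr => l _; rewrite Hc.
have RG' l : R (G' l) by apply: funring_comb => // m; apply: funring_monof.
have [|n en [H fH WH]] := hopf_dim HR pZ (ltn0Sn (e * k)) (ltn0Sn k) RG' Ry fG' fy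
   (linspace_inspan Z (fun m : homon k.+1 e.+1 => monof y (mnm_of m))).
  move=> l j; apply: (@inspan_ext _ _ _ _ _ _
      (fun x => \sum_m c l m * (monof y (mnm_of m) x * y j x))).
    by move=> x _; rewrite mulr_suml; apply: eq_bigr => m _; rewrite mulrA.
  apply: inspan_sum => m _.
  have [|m' em'] := @homonP k.+1 e.+1 (mnm_of m + U_(j))%MM.
    by rewrite mdegD mdeg_mnm_of mdeg1 addn1.
  apply: inspan_ext (inspan_gen _ _ m') => x _; rewrite em' monofD; congr (_ * _).
  rewrite /monof (bigD1 j) //= mnm1E eqxx expr1 big1 ?mulr1 // => l' nl.
  by rewrite mnm1E eq_sym (negPf nl).
have {}en : n = (e.+1 * k).+1 by move: en; rewrite mulSn; lia.
by rewrite en in H fH WH; exists H.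
Qed.

End HomogeneousMonomials.

(** * Points in general position and parameter counts *)

Section Sampling.
Variables (F : fieldType) (T : Type) (R : (T -> F) -> Prop) (Z : T -> Prop).
Hypotheses (HR : funring R) (pZ : primeset R Z).

Definition ord_cons (A : Type) s (a : A) (f : 'I_s -> A) (l : 'I_s.+1) : A :=
  if unlift ord0 l is Some l' then f l' else a.

Lemma ord_cons0 (A : Type) s (a : A) (f : 'I_s -> A) : ord_cons a f ord0 = a.
Proof. by rewrite /ord_cons unlift_none. Qed.

Lemma ord_consS (A : Type) s (a : A) (f : 'I_s -> A) l :
  ord_cons a f (lift ord0 l) = f l.
Proof. by rewrite /ord_cons liftK. Qed.

(** Functions of separate points satisfy no common relation [c], even on tuples imposing independent
    conditions on [A]. Points are added one at a time; each new point must avoid the zeros of two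
    functions that do not vanish on [Z], and primality lets it avoid both. *)
Lemma sample_points_row_free s n (J : finType) (A : 'I_n -> T -> F) (B : J -> T -> F)
    (c : {ffun 'I_s -> J} -> F) b0 :
    (s <= n)%N -> (forall i, R (A i)) -> (forall j, R (B j)) ->
    lfree Z A -> lfree Z B -> c b0 != 0 ->
  exists p : 'I_s -> T, [/\ forall l, Z (p l),
    \sum_b c b * \prod_l B (b l) (p l) != 0 &
    row_free (\matrix_(l < s, l' < n) A l' (p l))].
Proof.
move=> + RA RB fA fB; elim: s c b0 => [|s IH] c b0 les nz.
  exists (fun l => match notF (etrans (esym (ltn0 _)) (ltn_ord l)) with end); split.
  - by case.
  - rewrite (bigD1 b0) //= big_ord0 mulr1 big1 ?addr0 // => b /eqP[].
    by apply/ffunP; case.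
  - by rewrite -kermx_eq0; apply/eqP/matrixP; case.
pose cons j (b : {ffun 'I_s -> J}) : {ffun 'I_s.+1 -> J} := [ffun l => ord_cons j b l].
pose tl (b : {ffun 'I_s.+1 -> J}) : {ffun 'I_s -> J} := [ffun l => b (lift ord0 l)].
have consK (b : {ffun 'I_s.+1 -> J}) : cons (b ord0) (tl b) = b.
  apply/ffunP => l; rewrite ffunE; case: (unliftP ord0 l) => [l' ->|->].
    by rewrite ord_consS ffunE.
  by rewrite ord_cons0.
have tlK j b : tl (cons j b) = b.
  by apply/ffunP => l; rewrite !ffunE ord_consS.
have hdK j b : cons j b ord0 = j by rewrite ffunE ord_cons0.
have [|p [Zp nzp frp]] := IH (fun b => c (cons (b0 ord0) b)) (tl b0) (ltnW les).
  by rewrite consK.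
(* The relation as a function of the new point alone; by induction its coefficient at [b0 ord0] is
   nonzero. *)
pose G x := \sum_j (\sum_b c (cons j b) * \prod_l B (b l) (p l)) * B j x.
have RG : R G by apply: funring_comb.
have NG : ~ vanish Z G by move/fB/(_ (b0 ord0))/eqP; exact/negP.
pose N : 'M[F]_(s, n) := \matrix_(l, l') A l' (p l).
(* [combof A v] vanishes at the old points, so a point where it does not vanish adds an independent
   row. *)
have [v vN nzv] : exists2 v : 'rV[F]_n, v *m N^T = 0 & v != 0.
  have : kermx N^T != 0.
    rewrite -mxrank_eq0 mxrank_ker mxrank_tr -lt0n subn_gt0.
    exact: leq_ltn_trans (rank_leq_row _) les.
  by case/rowV0Pn => v /sub_kermxP vN nzv; exists v.
have Nw : ~ vanish Z (combof A v).
  by move/(proj1 (lfreeV Z A) fA)/eqP; rewrite (negPf nzv).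
have [x Zx /eqP nzx] : exists2 x, Z x & G x * combof A v x <> 0.
  apply: NNPP => H; have [||//|//] := pZ RG (v := combof A v).
    exact: funring_comb.
  by move=> x Zx; apply: NNPP => Hx; apply: H; exists x.
move: nzx; rewrite mulf_eq0 negb_or => /andP[Gx wx].
exists (ord_cons x p); split.
- by move=> l; rewrite /ord_cons; case: unlift.
- move: Gx; congr (_ != _); rewrite /G.
  under eq_bigr do rewrite mulr_suml.
  rewrite pair_big /=.
  rewrite (reindex (fun b : {ffun 'I_s.+1 -> J} => (b ord0, tl b))) /=; last first.
    exists (fun q : J * {ffun 'I_s -> J} => cons q.1 q.2) => [b _|[j b] _] /=.
      exact: consK.
    by rewrite hdK tlK.
  apply: eq_bigr => b _; rewrite consK -mulrA; congr (_ * _).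
  rewrite big_ord_recl ord_cons0 mulrC; congr (_ * _).
  by apply: eq_bigr => l _; rewrite ord_consS ffunE.
rewrite -kermx_eq0; apply/rowV0P => u /sub_kermxP uN.
have uNj j : u 0 ord0 * A j x + \sum_l u 0 (lift ord0 l) * A j (p l) = 0.
  have := congr1 (fun w : 'rV_n => w 0 j) uN; rewrite !mxE big_ord_recl mxE ord_cons0.
  by move=> e; rewrite -[RHS]e; congr (_ + _); apply: eq_bigr => l _; rewrite mxE ord_consS.
have u0 : u 0 ord0 = 0.
  apply: (mulIf wx); rewrite mul0r /combof.
  have e : \sum_j v 0 j * (u 0 ord0 * A j x + \sum_l u 0 (lift ord0 l) * A j (p l)) = 0.
    by rewrite big1 // => j _; rewrite uNj mulr0.
  rewrite -[RHS]e mulr_sumr.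
  under [RHS]eq_bigr do rewrite mulrDr mulr_sumr.
  rewrite big_split exchange_big /= [X in _ = _ + X]big1 ?addr0.
    by apply: eq_bigr => j _; rewrite mulrCA.
  move=> l _; have := congr1 (fun w : 'rV_s => w 0 l) vN; rewrite !mxE => e'.
  rewrite -[RHS](mulr0 (u 0 (lift ord0 l))) -[in RHS]e' mulr_sumr.
  by apply: eq_bigr => j _; rewrite !mxE mulrCA.
have ut : (\row_l u 0 (lift ord0 l)) = 0 :> 'rV_s.
  apply: (row_free_inj frp); rewrite mul0mx; apply/rowP => j; rewrite !mxE.
  rewrite -[RHS](uNj j) u0 mul0r add0r; apply: eq_bigr => l _.
  by rewrite !mxE.
apply/rowP => l; rewrite mxE; case: (unliftP ord0 l) => [l' ->|->//].
by have := congr1 (fun w : 'rV_s => w 0 l') ut; rewrite !mxE.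
Qed.

Lemma sample_points n (J : finType) (A : 'I_n -> T -> F) (B : J -> T -> F)
    (c : {ffun 'I_n -> J} -> F) b0 :
    (forall i, R (A i)) -> (forall j, R (B j)) ->
    lfree Z A -> lfree Z B -> c b0 != 0 ->
  exists p : 'I_n -> T, [/\ forall l, Z (p l),
    \sum_b c b * \prod_l B (b l) (p l) != 0 &
    \det (\matrix_(l, l') A l' (p l)) != 0].
Proof.
move=> RA RB fA fB nz.
have [p [Zp nzp fr]] := sample_points_row_free (leqnn n) RA RB fA fB nz.
by exists p; split=> //; move: fr; rewrite row_free_unit unitmxE unitfE.
Qed.

End Sampling.

Lemma funring_det (F : fieldType) (U : Type) (R : (U -> F) -> Prop) n
    (M : 'I_n -> 'I_n -> U -> F) :
  funring R -> (forall i j, R (M i j)) -> R (fun x => \det (\matrix_(i, j) M i j x)).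
Proof.
move=> HR RM.
have -> : (fun x => \det (\matrix_(i, j) M i j x)) =
          (fun x => \sum_(s : 'S_n) (-1) ^+ s * \prod_i M i (s i) x).
  apply: functional_extensionality => x; apply: eq_bigr => s _; congr (_ * _).
  by apply: eq_bigr => i _; rewrite mxE.
apply: funring_sum => // s _; apply: (funring_mul HR (funring_cst HR _)).
exact: funring_prod.
Qed.

Lemma funring_adj (F : fieldType) (U : Type) (R : (U -> F) -> Prop) n
    (M : 'I_n -> 'I_n -> U -> F) i j :
    funring R -> (forall i j, R (M i j)) ->
  R (fun x => (\adj (\matrix_(i, j) M i j x)) i j).
Proof.
move=> HR RM.
congr R: (funring_mul HR (funring_cst HR ((-1) ^+ (j + i)%N))
  (funring_det HR (fun a b => RM (lift j a) (lift i b)))).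
apply: functional_extensionality => x; rewrite mxE /cofactor; congr (_ * _).
by congr (\det _); apply/matrixP => a b; rewrite !mxE.
Qed.

(** * Functions rational in finitely many parameters *)

Section RationalParameters.
Variables (F : fieldType) (U : Type) (S : U -> Prop).
Variables (r : nat) (y : 'I_r -> U -> F).

Definition polyon (u : U -> F) := exists p : {mpoly F[r]},
  forall x, S x -> u x = p.@[fun j => y j x].

Lemma polyon_funring : funring polyon.
Proof.
split=> [c|u v [p1 H1] [p2 H2]|u v [p1 H1] [p2 H2]].
- by exists c%:MP => x _; rewrite mevalC.
- by exists (p1 + p2) => x Sx; rewrite mevalD H1 ?H2.
- by exists (p1 * p2) => x Sx; rewrite mevalM H1 ?H2.
Qed.

Lemma polyon_ext u v : (forall x, S x -> u x = v x) -> polyon u -> polyon v.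
Proof. by move=> uv [p H]; exists p => x Sx; rewrite -uv // H. Qed.

Lemma polyon_param j : polyon (y j).
Proof. by exists 'X_j => x _; rewrite mevalXU. Qed.

Variable D : {mpoly F[r]}.

Let Delta x := D.@[fun j => y j x].

Hypothesis Delta_neq0 : forall x, S x -> Delta x != 0.

Definition quotpoly (u : U -> F) := exists w (p : {mpoly F[r]}),
  forall x, S x -> Delta x ^+ w * u x = p.@[fun j => y j x].

Lemma quotpoly_funring : funring quotpoly.
Proof.
split=> [c|u v [w1 [p1 H1]] [w2 [p2 H2]]|u v [w1 [p1 H1]] [w2 [p2 H2]]].
- by exists 0%N, c%:MP => x _; rewrite mul1r mevalC.
- exists (w1 + w2)%N, (D ^+ w2 * p1 + D ^+ w1 * p2) => x Sx.
  rewrite mevalD !mevalM !rmorphXn /= -H1 // -H2 // exprD mulrDr -/(Delta x).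
  by rewrite !mulrA [_ ^+ w2 * _ ^+ w1]mulrC.
- exists (w1 + w2)%N, (p1 * p2) => x Sx.
  by rewrite mevalM -H1 // -H2 // exprD mulrACA.
Qed.

Lemma quotpoly_ext u v : (forall x, S x -> u x = v x) -> quotpoly u -> quotpoly v.
Proof. by move=> uv [w [p H]]; exists w, p => x Sx; rewrite -uv // H. Qed.

Lemma quotpoly_polyon u : polyon u -> quotpoly u.
Proof. by move=> [p H]; exists 0%N, p => x Sx; rewrite mul1r H. Qed.

Lemma quotpoly_div u : polyon (fun x => Delta x * u x) -> quotpoly u.
Proof. by move=> [p H]; exists 1%N, p => x Sx; rewrite expr1 H. Qed.

(** After multiplication by one power of [Delta], all monomials in [g] with exponents below [K]
    become polynomials in the [r] parameters of degree [O(K)], and these span only [O(K^r)]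
    dimensions. *)
Lemma algfree_param (A : finType) (g : A -> U -> F) :
  (forall j, quotpoly (g j)) -> algfree S g -> (#|A| <= r)%N.
Proof.
move=> qg fg; rewrite leqNgt; apply/negP => ltrA.
have [W HW] : exists W, forall j, exists p : {mpoly F[r]},
    forall x, S x -> Delta x ^+ W * g j x = p.@[fun j => y j x].
  apply: fin_exists_bound => // j m m' lem [p Hp].
  exists (D ^+ (m' - m) * p) => x Sx.
  by rewrite mevalM rmorphXn -Hp //= -/(Delta x) mulrA -exprD subnK.
have [d Hd] : exists d, forall j, exists2 p : {mpoly F[r]}, (msize p <= d.+1)%N &
    forall x, S x -> Delta x ^+ W * g j x = p.@[fun j => y j x].
  apply: fin_exists_bound => [j m m' lem [p sp Hp]|j].
    by exists p => //; apply: leq_trans sp _.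
  by have [p Hp] := HW j; exists (msize p); exists p.
have [p sp Hp] := fin_all_exists2 Hd.
pose M := #|A|; pose e := msize D.
have sD : (msize D <= e.+1)%N by exact: leqnSn.
(* Each of the [M] factors below has degree at most [W * K * e + K * d]. *)
pose C := (M * (W * e + d))%N.
have [K K0 HK] := poly_growth C 1 r.
have : (#|{ffun A -> 'I_K}| <= #|{ffun 'I_r -> 'I_(C * K).+1}|)%N.
  apply: (lfree_card (Y := fun a : {ffun 'I_r -> 'I_(C * K).+1} => monof y (fun j => a j))
      (u := fun x => Delta x ^+ (W * K * M))) (fg K) => [x Sx|a].
    by rewrite expf_neq0 ?Delta_neq0.
  apply: (@inspan_ext _ _ _ _ _ _
     (fun x => (\prod_j (D ^+ (W * (K - a j)) * p j ^+ a j)).@[fun j => y j x])).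
    move=> x Sx; rewrite rmorph_prod exprM /M -prodr_const -big_split.
    apply: eq_bigr => j _ /=; rewrite mevalM !rmorphXn /= -Hp // -/(Delta x).
    by rewrite exprMn mulrA -exprM -exprD -mulnDr subnK // ltnW.
  apply: (inspan_meval (L := (C * K)%N)).
    move=> m dm; pose a' : {ffun 'I_r -> 'I_(C * K).+1} := [ffun j => inord (m j)].
    apply: inspan_ext (inspan_gen _ _ a') => x _; apply: eq_bigr => j _.
    rewrite ffunE inordK // ltnS (leq_trans _ dm) //.
    by rewrite mdegE (bigD1 j) //= leq_addr.
  rewrite /C -mulnA; apply: msize_prod_deg => j.
  apply: leq_trans (msizeM_deg (msizeX_deg _ sD) (msizeX_deg _ (sp j))) _.
  rewrite ltnS mulnDl mulnAC [(d * K)%N]mulnC.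
  by rewrite leq_add // leq_mul // ?leq_mul // ?leq_subr // ltnW.
rewrite !card_ffun !card_ord leqNgt -/M => /negP; apply.
rewrite mul1n in HK; apply: leq_trans HK _.
by rewrite leq_pexp2l.
Qed.

End RationalParameters.

(** * Chains of closed sets *)

(** A nonzero [a] is required because it will rescale vectors that represent projective points. *)
Lemma poly_nonroot (F : numFieldType) (q : {poly F}) :
  q != 0 -> exists2 a, a != 0 & q.[a] != 0.
Proof.
move=> nz; pose s : seq F := [seq i%:R | i <- iota 1 (size q)].
have us : uniq s by rewrite map_inj_uniq ?iota_uniq //; exact: (mulrIn (oner_neq0 F)).
have [/(max_poly_roots nz)/(_ us)|] := boolP (all (root q) s).
  by rewrite size_map size_iota ltnn.
case/allPn => a sa nr; exists a => //.
by case/mapP: sa => i; rewrite mem_iota => /andP[i1 _] ->; rewrite pnatr_eq0 -lt0n.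
Qed.

Section CoefficientSpace.
Variables n d : nat.

Lemma coord_fun_funring : funring (@coord_fun n).
Proof. by split=> *; [apply: cf_const|apply: cf_add|apply: cf_mul]. Qed.

Lemma homog_closed_zero a :
  coord_fun a -> homog_closed n d (fun f => Pd n d f /\ a f = 0).
Proof.
move=> ca; exists (fun b => b = a); split=> [b ->//|f].
split=> -[Pf af]; split=> //; first by move=> b ->.
exact: af.
Qed.

Lemma primeset_irreducible (Z : {mpoly CC[n]} -> Prop) :
  irreducible (homog_closed n d) Z -> primeset (@coord_fun n) Z.
Proof.
move=> [[F0 [_ HZ]] _ irr] u v cu cv uv.
case: (irr _ _ (homog_closed_zero cu) (homog_closed_zero cv)) => [f Zf|H|H].
- have Pf := proj1 (proj1 (HZ f) Zf).
  by have /eqP := uv f Zf; rewrite mulf_eq0 => /orP[]/eqP; [left|right].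
- by left=> f /H[].
- by right=> f /H[].
Qed.

Lemma vanish_zclosure (S : {mpoly CC[n]} -> Prop) a :
    (forall f, S f -> Pd n d f) -> coord_fun a ->
  vanish S a -> vanish (zclosure (homog_closed n d) S) a.
Proof.
move=> SP ca Va f Hf.
have [] // : Pd n d f /\ a f = 0.
apply: (Hf (fun f => Pd n d f /\ a f = 0)); last by move=> g Sg; split; auto.
exact: homog_closed_zero.
Qed.

Lemma zclosure_Pd (S : {mpoly CC[n]} -> Prop) f :
  (forall f, S f -> Pd n d f) -> zclosure (homog_closed n d) S f -> Pd n d f.
Proof.
move=> SP; apply; last exact: SP.
by exists (fun=> False); split=> // g; split=> [|[]].
Qed.

Lemma chain_coord_algfree (X : {mpoly CC[n]} -> Prop) m :
  chain_in (homog_closed n d) X m ->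
  exists Z (h : nat -> {mpoly CC[n]} -> CC),
    [/\ irreducible (homog_closed n d) Z, subs Z X, forall j, coord_fun (h j) &
        algfree Z (fun j : 'I_m => h j)].
Proof.
move=> [c [irrc subc]].
have /fin_all_exists[h Hh] (j : 'I_m) : exists h, [/\ coord_fun h, vanish (c j) h &
    ~ vanish (c j.+1) h].
  have [_ Nsub] := subc j (ltn_ord j).
  have [[[F0 [HF0 Hcj]] _ _] _] := irrc j (ltnW (ltn_ord j)).
  have [[[F1 [_ Hcj1]] _ _] _] := irrc j.+1 (ltn_ord j).
  have [f Nf] := not_all_ex_not _ _ Nsub.
  have [cf Ncf] := imply_to_and _ _ Nf.
  have Pf := proj1 (proj1 (Hcj1 f) cf).
  have [a Na] : exists a, ~ (F0 a -> a f = 0).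
    apply: not_all_ex_not => Ha; apply: Ncf; exact/Hcj.
  have [F0a naf] := imply_to_and _ _ Na.
  exists a; split; first exact: HF0.
    by move=> g /Hcj[_]; apply.
  by move/(_ f cf).
pose h' j := if insub j is Some j' then h j' else fun=> 0.
have ch' j : coord_fun (h' j).
  by rewrite /h'; case: insubP => [j' _ _|_]; [case: (Hh j')|apply: cf_const].
exists (c m), h'; have [irr0 sub0] := irrc m (leqnn m); split=> //.
apply: (chain_algfree coord_fun_funring (b := 0)) => //.
- by move=> j ltj; apply: primeset_irreducible; case: (irrc j.+1 ltj).
- by move=> j ltj; case: (subc j ltj).
- move=> j ltj; rewrite /h' add0n insubT /=; by case: (Hh (Sub j ltj)).
have [[_ [f cf] _] _] := irrc 0%N isT.
move=> K b /(_ f cf) Hb a.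
rewrite (bigD1 a) //= [X in _ + X]big1 ?addr0 in Hb; last first.
  by move=> b' /eqP[]; apply/ffunP; case.
by move: Hb; rewrite /monof big_ord0 mulr1.
Qed.

Lemma coord_fun_line a (f g : {mpoly CC[n]}) :
  coord_fun a -> exists q : {poly CC}, forall t, a (f + t *: g) = q.[t].
Proof.
elim=> [c|m|a1 a2 _ [q1 H1] _ [q2 H2]|a1 a2 _ [q1 H1] _ [q2 H2]].
- by exists c%:P => t; rewrite hornerC.
- by exists ((f@_m)%:P + g@_m *: 'X) => t; rewrite !hornerE mcoeffD mcoeffZ mulrC.
- by exists (q1 + q2) => t; rewrite hornerD H1 H2.
- by exists (q1 * q2) => t; rewrite hornerM H1 H2.
Qed.

(** A point outside [A] and a point outside [B] are joined by a line inside the linear space. One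
    equation of each set restricts to a nonzero polynomial on that line, so some point of the line
    lies in neither. *)
Lemma irreducible_coefs0 (E : 'X_{1..n} -> Prop) :
  irreducible (homog_closed n d) (fun f => Pd n d f /\ forall m, E m -> f@_m = 0).
Proof.
split.
- exists (fun a => exists2 m, E m & a = mcoeff m); split.
    by move=> a [m _ ->]; apply: cf_coef.
  move=> f; split=> -[Pf Hf]; split=> //; first by move=> a [m Em ->]; apply: Hf.
  by move=> m Em; apply: (Hf (mcoeff m)); exists m.
- by exists 0; split=> [|m _]; [exact: dhomog0|rewrite mcoeff0].
move=> A B [FA [HFA HA]] [FB [HFB HB]] sub; apply: NNPP => /not_or_and[NA NB].
have sep (D : {mpoly CC[n]} -> Prop) (FD : ({mpoly CC[n]} -> CC) -> Prop) :
    (forall f, D f <-> Pd n d f /\ forall a, FD a -> a f = 0) ->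
    ~ subs (fun f => Pd n d f /\ forall m, E m -> f@_m = 0) D ->
    exists f a, [/\ Pd n d f, forall m, E m -> f@_m = 0, FD a & a f <> 0].
  move=> HD ND; have [f Nf] := not_all_ex_not _ _ ND.
  have [[Pf Ef] NDf] := imply_to_and _ _ Nf.
  have [a Na] : exists a, ~ (FD a -> a f = 0).
    by apply: not_all_ex_not => Ha; apply: NDf; apply/HD.
  by have [Fa naf] := imply_to_and _ _ Na; exists f, a.
have [f [a [Pf Ef Fa af]]] := sep _ _ HA NA.
have [g [b [Pg Eg Fb bg]]] := sep _ _ HB NB.
have [qa Hqa] := coord_fun_line f (g - f) (HFA _ Fa).
have [qb Hqb] := coord_fun_line f (g - f) (HFB _ Fb).
have nza : qa != 0.
  by apply/eqP => q0; apply: af; have := Hqa 0; rewrite scale0r addr0 q0 horner0.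
have nzb : qb != 0.
  by apply/eqP => q0; apply: bg; have := Hqb 1; rewrite scale1r addrC subrK q0 horner0.
have [t _] := poly_nonroot (mulf_neq0 nza nzb).
rewrite hornerM mulf_eq0 negb_or -Hqa -Hqb => /andP[/eqP na /eqP nb].
have [] := sub (f + t *: (g - f)).
- split=> [|m Em].
    by apply: dhomogD => //; apply: dhomogZ; apply: dhomogD => //; rewrite dhomogN.
  by rewrite mcoeffD mcoeffZ mcoeffB Ef // Eg // subr0 mulr0 addr0.
- by move/HA => [_ /(_ a Fa)].
- by move/HB => [_ /(_ b Fb)].
Qed.

(** A flag of coordinate subspaces. It bounds the dimension of the ambient space from below, the
    only direction that the codimension bound needs. *)
Lemma chain_Pd : chain_in (homog_closed n d) (Pd n d) #|homon n d|.
Proof.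
pose E j m := exists2 m' : homon n d, mnm_of m' = m & (j <= enum_rank m')%N.
exists (fun j f => Pd n d f /\ forall m, E j m -> f@_m = 0).
split=> [j _|j ltj]; first by split=> [|f []//]; exact: irreducible_coefs0.
split=> [f [Pf Hf]|H].
  split=> // m [m' em lej]; apply: Hf; exists m' => //; exact: ltnW.
pose m0 := enum_val (Ordinal ltj).
have [] := H 'X_[mnm_of m0].
  split=> [|m [m' <- lej]]; first by rewrite /Pd dhomogX; apply/eqP; exact: mdeg_mnm_of.
  rewrite mcoeffX; case: eqP => // /mnm_of_inj em.
  by move: lej; rewrite -em enum_valK /= ltnn.
move=> _ /(_ (mnm_of m0)); rewrite mcoeffX eqxx => /(_ _)/eqP; rewrite oner_eq0.
by move=> N; apply: notF; apply: N; exists m0; rewrite ?enum_valK.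
Qed.

End CoefficientSpace.

(** * Closed sets of projective space as cones *)

Section ProjectiveSpace.
Variable n : nat.
Implicit Types (Z : 'rV[CC]_n -> Prop).

(** All polynomials, not only forms: on representing vectors a closed set is a punctured cone, and
    these are the functions on the cone. *)
Definition evfun (u : 'rV[CC]_n -> CC) := exists g, u = ev g.

Lemma evfun_funring : funring evfun.
Proof.
split=> [c|u v [g ->] [h ->]|u v [g ->] [h ->]].
- by exists c%:MP; apply: functional_extensionality => x; rewrite /ev mevalC.
- by exists (g + h); apply: functional_extensionality => x; rewrite /ev mevalD.
- by exists (g * h); apply: functional_extensionality => x; rewrite /ev mevalM.
Qed.

Lemma ev_homog_scale e (g : {mpoly CC[n]}) t x :
  g \is e.-homog -> ev g (t *: x) = t ^+ e * ev g x.
Proof.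
move=> /dhomogP Hg; rewrite /ev !mevalE mulr_sumr big_seq [RHS]big_seq.
apply: eq_bigr => m /Hg dm; rewrite mulrCA; congr (_ * _).
under eq_bigr do rewrite mxE exprMn.
by rewrite big_split /= prodrXr -mdegE dm.
Qed.

Lemma proj_closed_scale Z t x : proj_closed Z -> t != 0 -> Z x -> Z (t *: x).
Proof.
move=> [G [HG HZ]] nt /HZ[nx Hx]; apply/HZ; split=> [|g Gg].
  by rewrite scaler_eq0 negb_or nt.
by have [e he] := HG g Gg; rewrite (ev_homog_scale _ _ he) Hx // mulr0.
Qed.

Lemma ev_line (g : {mpoly CC[n]}) t x :
  ev g (t *: x) = (\poly_(e < msize g) ev (pihomog mdeg e g) x).[t].
Proof.
rewrite horner_poly {1}(pihomog_partitionE (leqnn (msize g))) /ev raddf_sum /=.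
by apply: eq_bigr => e _; rewrite -/(ev _ _) (ev_homog_scale _ _ (pihomogP _ _ _)) mulrC.
Qed.

(* [g h] vanishes along the line through [x] iff the homogeneous components
   of [g], or those of [h], all vanish at [x]. *)
Lemma primeset_proj Z : irreducible (@proj_closed n) Z -> primeset evfun Z.
Proof.
move=> [clZ _ irr] _ _ [g ->] [h ->] gh.
pose comp (g : {mpoly CC[n]}) (x : 'rV[CC]_n) := x != 0 /\ forall p, (exists e, p = pihomog mdeg e g) -> ev p x = 0.
have clcomp p : proj_closed (comp p).
  exists (fun q => exists e, q = pihomog mdeg e p); split=> // q [e ->].
  by exists e; apply: pihomogP.
have compP p x : x != 0 -> \poly_(e < msize p) ev (pihomog mdeg e p) x = 0 -> comp p x.
  move=> nx /polyP H; split=> // q [e ->]; have := H e; rewrite coef_poly coef0.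
  case: ltnP => // le _; rewrite (_ : pihomog _ _ _ = 0) /ev ?meval0 //.
  rewrite pihomogE big_seq_cond big1 // => m /andP[/msize_mdeg_lt lt /eqP em].
  by move: lt; rewrite em ltnNge le.
have comp0 p : subs Z (comp p) -> vanish Z (ev p).
  move=> sub x /sub[_ H]; rewrite -[x]scale1r ev_line horner_poly big1 // => e _.
  by rewrite H ?mul0r //; exists (val e).
case: (irr _ _ (clcomp g) (clcomp h)) => [x Zx|/comp0|/comp0]; [|by left|by right].
have nx : x != 0 by case: clZ => G [_ HZ]; case/HZ: Zx.
set q := \poly_(e < msize g) ev (pihomog mdeg e g) x.
set r := \poly_(e < msize h) ev (pihomog mdeg e h) x.
have [/eqP|nz] := eqVneq (q * r) 0.
  by rewrite mulf_eq0 => /orP[]/eqP/compP; [left|right]; auto.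
have [t nt /eqP[]] := poly_nonroot nz.
by rewrite hornerM -!ev_line; apply: gh; apply: proj_closed_scale.
Qed.

(** The cone has one dimension more than the projective set, hence [i.+1]. The extra function is a
    coordinate not vanishing at a point of the smallest member; it is transcendental there because
    that member is stable under scaling. *)
Lemma chain_proj_algfree X i : chain_in (@proj_closed n) X i ->
  exists h : 'I_i.+1 -> 'rV[CC]_n -> CC,
    (forall j, evfun (h j)) /\ algfree X h.
Proof.
move=> [c [irrc subc]].
have /fin_all_exists[h Hh] (j : 'I_i) : exists h, [/\ evfun h, vanish (c j) h &
    ~ vanish (c j.+1) h].
  have [_ Nsub] := subc j (ltn_ord j).
  have [[[F0 [HF0 Hcj]] _ _] _] := irrc j (ltnW (ltn_ord j)).
  have [[[F1 [_ Hcj1]] _ _] _] := irrc j.+1 (ltn_ord j).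
  have [x Nx] := not_all_ex_not _ _ Nsub.
  have [cx Ncx] := imply_to_and _ _ Nx.
  have nx := proj1 (proj1 (Hcj1 x) cx).
  have [g Ng] : exists g, ~ (F0 g -> ev g x = 0).
    apply: not_all_ex_not => Hg; apply: Ncx; exact/Hcj.
  have [F0g ngx] := imply_to_and _ _ Ng.
  exists (ev g); split; first by exists g.
    by move=> z /Hcj[_]; apply.
  by move/(_ x cx).
have [[cl0 [x cx] _] _] := irrc 0%N isT.
have [l nxl] : exists l, x 0 l != 0.
  have nx : x != 0 by case: cl0 => G [_ H0]; case/H0: cx.
  apply: NNPP => N; case/eqP: nx; apply/rowP => l; rewrite mxE.
  by apply/eqP/negPn/negP => H; apply: N; exists l.
pose h' j := if j is j'.+1 then (if insub j' is Some j'' then h j'' else ev 0) else ev 'X_l.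
have eh' j : evfun (h' j).
  case: j => [|j]; first by exists 'X_l.
  by rewrite /h'; case: insubP => [j' _ _|_]; [case: (Hh j')|exists 0].
exists (fun j => h' j); split=> // K.
have [_ subX] := irrc i (leqnn i); apply: lfree_sub subX _; move: K.
apply: (chain_algfree evfun_funring (b := 1)) => //.
- by move=> j ltj; apply: primeset_proj; case: (irrc j.+1 ltj).
- by move=> j ltj; case: (subc j ltj).
- by move=> j ltj; rewrite /h' add1n insubT /=; case: (Hh (Sub j ltj)).
move=> K b Hb a.
pose q : {poly CC} := \sum_a (b a * x 0 l ^+ a ord0) *: 'X^(a ord0).
have q0 : q = 0.
  apply/eqP; apply: contraT => /poly_nonroot[t nt /eqP[]].
  rewrite -[RHS](Hb _ (proj_closed_scale cl0 nt cx)) /q horner_sum.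
  apply: eq_bigr => a' _; rewrite hornerZ hornerXn /monof big_ord1 /= /ev mevalXU mxE.
  by rewrite exprMn -mulrA [_ ^+ _ * t ^+ _]mulrC.
have := congr1 (fun p : {poly CC} => p`_(a ord0)) q0; rewrite coef0 coef_sum (bigD1 a) //=.
rewrite big1 ?addr0 => [|a' na].
  rewrite coefZ coefXn eqxx mulr1 => /eqP; rewrite mulf_eq0 expf_eq0 (negPf nxl) andbF orbF.
  by move/eqP.
rewrite coefZ coefXn; case: eqP => [e|]; rewrite ?mulr0 //.
case/eqP: na; apply/ffunP => j; rewrite (ord1 j); exact/val_inj/esym.
Qed.

End ProjectiveSpace.

(** * Linear substitutions and restriction to a plane *)

Section Substitution.
Variable F : fieldType.

Lemma mpoly_ring_ind n (Q : {mpoly F[n]} -> Prop) :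
    (forall c, Q c%:MP) -> (forall i, Q 'X_i) ->
    (forall p q, Q p -> Q q -> Q (p + q)) -> (forall p q, Q p -> Q q -> Q (p * q)) ->
  forall p, Q p.
Proof.
move=> Qc QX QD QM p; rewrite [p]mpolyE.
elim/big_ind: _ => [|p1 p2|m _]; [by rewrite -mpolyC0|exact: QD|].
rewrite -mul_mpolyC; apply: (QM) => //; rewrite mpolyXE_id.
elim/big_ind: _ => [|p1 p2|i _]; [by rewrite -mpolyC1|exact: QM|].
elim: (m i) => [|k IH]; first by rewrite expr0 -mpolyC1.
by rewrite exprS; apply: QM.
Qed.

Lemma homog_expand n e (p : {mpoly F[n]}) : p \is e.-homog ->
  p = \sum_(m : homon n e) p@_(mnm_of m) *: 'X_[mnm_of m].
Proof.
move=> Hp; apply/mpolyP => m; rewrite raddf_sum /=.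
under eq_bigr do rewrite mcoeffZ mcoeffX.
have [dm|nm] := eqVneq (mdeg m) e.
  rewrite (bigD1 (to_homon dm)) //= to_homonK eqxx mulr1 big1 ?addr0 // => m' nm'.
  case: eqP => [em|]; rewrite ?mulr0 //; case/eqP: nm'; exact: mnm_of_inj.
rewrite (dhomog_nemf_coeff Hp nm) big1 // => m' _; case: eqP => [em|]; rewrite ?mulr0 //.
by rewrite -em mdeg_mnm_of eqxx in nm.
Qed.

Lemma dhomog_mderiv n e (p : {mpoly F[n]}) s :
  p \is e.+1.-homog -> p^`M(s) \is e.-homog.
Proof.
move=> /dhomogP Hp; apply/dhomogP => m; rewrite mcoeff_msupp mcoeff_mderiv => nz.
have /Hp : (m + U_(s))%MM \in msupp p.
  by rewrite mcoeff_msupp; apply: contraNneq nz => ->; rewrite mul0rn.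
by rewrite /= mdegD mdeg1 addn1 => -[].
Qed.

Definition lsubst n (M : 'M[F]_n) (f : {mpoly F[n]}) : {mpoly F[n]} :=
  f \mPo [tuple \sum_(j < n) M j l *: 'X_j | l < n].

Lemma lsubstE n (M : 'M[F]_n) f (z : 'rV[F]_n) :
  (lsubst M f).@[fun j => z 0 j] = f.@[fun j => (z *m M) 0 j].
Proof.
rewrite comp_mpoly_meval; apply: meval_eq => l; rewrite tnth_mktuple raddf_sum mxE /=.
by apply: eq_bigr => j _; rewrite mevalZ mevalXU mulrC.
Qed.

Lemma lsubstC n (M : 'M[F]_n) c : lsubst M c%:MP = c%:MP.
Proof. exact: comp_mpolyC. Qed.

Lemma lsubstX n (M : 'M[F]_n) l : lsubst M 'X_l = \sum_j M j l *: 'X_j.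
Proof. by rewrite /lsubst comp_mpolyXU -tnth_nth tnth_mktuple. Qed.

Lemma lsubstD n (M : 'M[F]_n) p q : lsubst M (p + q) = lsubst M p + lsubst M q.
Proof. exact: raddfD. Qed.

Lemma lsubstM n (M : 'M[F]_n) p q : lsubst M (p * q) = lsubst M p * lsubst M q.
Proof. exact: rmorphM. Qed.

Lemma lsubstZ n (M : 'M[F]_n) c p : lsubst M (c *: p) = c *: lsubst M p.
Proof. exact: comp_mpolyZ. Qed.

Lemma lsubst_sum n (M : 'M[F]_n) (I : finType) (p : I -> {mpoly F[n]}) :
  lsubst M (\sum_i p i) = \sum_i lsubst M (p i).
Proof. exact: raddf_sum. Qed.

Lemma lsubstK n (U V : 'M[F]_n) f : V *m U = 1%:M -> lsubst V (lsubst U f) = f.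
Proof.
move=> VU; elim/mpoly_ring_ind: f => [c|l|p q Hp Hq|p q Hp Hq].
- by rewrite !lsubstC.
- rewrite lsubstX lsubst_sum; under eq_bigr do rewrite lsubstZ lsubstX scaler_sumr.
  rewrite exchange_big /=.
  have E i : \sum_j U j l *: (V i j *: 'X_i) = (i == l)%:R *: 'X_i :> {mpoly F[n]}.
    under eq_bigr do rewrite scalerA mulrC.
    rewrite -scaler_suml; have := congr1 (fun W : 'M_n => W i l) VU.
    by rewrite !mxE => ->.
  under eq_bigr do rewrite E.
  rewrite (bigD1 l) //= eqxx scale1r big1 ?addr0 // => i /negPf ->.
  exact: scale0r.
- by rewrite !lsubstD Hp Hq.
- by rewrite !lsubstM Hp Hq.
Qed.

Lemma lsubst_homog n (M : 'M[F]_n) e f : f \is e.-homog -> lsubst M f \is e.-homog.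
Proof.
move=> Hf; rewrite [f](homog_expand Hf) lsubst_sum; apply: rpred_sum => m _.
rewrite lsubstZ; apply: dhomogZ; rewrite -[e in e.-homog](mdeg_mnm_of m) mdegE.
rewrite /lsubst comp_mpolyX.
have H (I : Type) (s : seq I) (p : I -> {mpoly F[n]}) (a : I -> nat) :
    (forall i, p i \is 1.-homog) ->
    \prod_(i <- s) p i ^+ a i \is (\sum_(i <- s) a i)%N.-homog.
  move=> Hp; elim: s => [|i s IH]; first by rewrite !big_nil dhomog1.
  rewrite !big_cons; apply: dhomogM => //.
  by have := dhomogMn (a i) (Hp i); rewrite mul1n.
apply: H => l; rewrite tnth_mktuple; apply: rpred_sum => j _; apply: dhomogZ.
by rewrite dhomogX; apply/eqP; exact: mdeg1.
Qed.

Lemma mderiv_lsubst n (U : 'M[F]_n) f s :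
  (lsubst U f)^`M(s) = \sum_j U s j *: lsubst U f^`M(j).
Proof.
elim/mpoly_ring_ind: f => [c|l|p q Hp Hq|p q Hp Hq].
- rewrite lsubstC mderivC big1 // => j _; rewrite mderivC.
  by rewrite -mpolyC0 lsubstC mpolyC0 scaler0.
- have dX j i : ('X_i : {mpoly F[n]})^`M(j) = (i == j)%:R%:MP.
    rewrite mderivX mnm1E; case: eqP => [->|_]; last by rewrite scale0r mpolyC0.
    have -> : (U_(j) - U_(j) = 0 :> 'X_{1..n})%MM.
      by apply/mnmP => h; rewrite mnmBE subnn mnm0E.
    by rewrite scale1r mpolyX0 mpolyC1.
  rewrite lsubstX raddf_sum (bigD1 s) //= mderivZ dX eqxx big1 => [|j nj]; last first.
    by rewrite mderivZ dX (negPf nj) mpolyC0 scaler0.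
  rewrite (bigD1 l) //= dX eqxx lsubstC big1 // => j nj.
  by rewrite dX eq_sym (negPf nj) lsubstC mpolyC0 scaler0.
- rewrite lsubstD mderivD Hp Hq -big_split; apply: eq_bigr => j _.
  by rewrite /= mderivD lsubstD scalerDr.
- rewrite lsubstM mderivM Hp Hq mulr_suml mulr_sumr -big_split; apply: eq_bigr => j _.
  by rewrite /= mderivM lsubstD !lsubstM scalerDr scalerAl scalerAr.
Qed.

End Substitution.

(** * Coordinates in which the plane is given by the first [k + 1] variables *)

Section Restriction.
Variables (F : fieldType) (N k : nat).
Hypothesis lekN : (k < N.+1)%N.

Definition wid (j : 'I_k.+1) : 'I_N.+1 := widen_ord lekN j.

Lemma wid_inj : injective wid.
Proof. by move=> i j /(congr1 val) /= /val_inj. Qed.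

Lemma wid_codom (j : 'I_N.+1) : (j \in codom wid) = (j <= k)%N.
Proof.
apply/codomP/idP => [[i ->]|lej]; first by rewrite /= -ltnS; exact: ltn_ord.
by exists (Ordinal (lej : (j < k.+1)%N)); apply: val_inj.
Qed.

Definition emb (m : 'X_{1..k.+1}) : 'X_{1..N.+1} :=
  [multinom (if insub (val j) is Some j' then m j' else 0%N) | j < N.+1].

Lemma emb_wid m j : emb m (wid j) = m j.
Proof.
rewrite mnmE /=; have -> // : insub (val j) = Some j :> option 'I_k.+1.
exact: valK.
Qed.

Lemma emb_out m (j : 'I_N.+1) : (k < j)%N -> emb m j = 0%N.
Proof. by move=> ltj; rewrite mnmE insubF // ltnS leqNgt ltj. Qed.

Lemma emb_inj : injective emb.
Proof. by move=> m1 m2 e; apply/mnmP => j; rewrite -!emb_wid e. Qed.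

Lemma embP (m : 'X_{1..N.+1}) : (forall j : 'I_N.+1, (k < j)%N -> m j = 0%N) ->
  exists m', m = emb m'.
Proof.
move=> H; exists [multinom m (wid j) | j < k.+1]; apply/mnmP => j.
have [lej|ltj] := leqP j k; last by rewrite H // emb_out.
by have /codomP[i ->] : j \in codom wid; rewrite ?wid_codom // emb_wid mnmE.
Qed.

Lemma mdeg_emb m : mdeg (emb m) = mdeg m.
Proof.
rewrite !mdegE; have := @big_injl nat _ _ wid (fun j => emb m j) wid_inj.
move=> -> => [|j]; last by rewrite wid_codom -ltnNge => /emb_out.
by apply: eq_bigr => j _; rewrite emb_wid.
Qed.

Definition emb_homon e (m : homon k.+1 e) : homon N.+1 e :=
  to_homon (etrans (mdeg_emb (mnm_of m)) (mdeg_mnm_of m)).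

Lemma emb_homon_inj e : injective (@emb_homon e).
Proof. by move=> m1 m2 /(congr1 (@mnm_of _ _)) /emb_inj/mnm_of_inj. Qed.

Lemma emb_homonP e (m : homon N.+1 e) :
  m \notin codom (@emb_homon e) -> exists2 j : 'I_N.+1, (k < j)%N & mnm_of m j != 0%N.
Proof.
move=> /codomP N1; apply: NNPP => N2; apply: N1.
have [|m' em] := @embP (mnm_of m).
  by move=> j ltj; apply/eqP/negPn/negP => nz; apply: N2; exists j.
have dm' : mdeg m' = e by rewrite -mdeg_emb -em mdeg_mnm_of.
by exists (to_homon dm'); apply: mnm_of_inj.
Qed.

Lemma meval_supported e (g : {mpoly F[N.+1]}) (z : 'I_N.+1 -> F) :
    g \is e.-homog -> (forall j : 'I_N.+1, (k < j)%N -> z j = 0) ->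
  g.@[z] = \sum_(m : homon k.+1 e) g@_(emb (mnm_of m)) * \prod_j z (wid j) ^+ mnm_of m j.
Proof.
move=> Hg z0; rewrite {1}(homog_expand Hg) raddf_sum /=.
under eq_bigr do rewrite mevalZ mevalX.
rewrite (big_injl (@emb_homon_inj e)) => [|m /emb_homonP[j ltj nz]]; last first.
  by rewrite (bigD1 j) //= z0 // expr0n (negPf nz) mul0r mulr0.
apply: eq_bigr => m _; congr (_ * _).
rewrite (bigID (mem (codom wid))) /= [X in _ * X]big1 ?mulr1 => [|j]; last first.
  by rewrite wid_codom -ltnNge => ltj; rewrite emb_out // expr0.
transitivity (\prod_(j in [set wid i | i in 'I_k.+1]) z j ^+ emb (mnm_of m) j).
  by apply: eq_bigl => j; apply/codomP/imsetP => [[i ->]|[i _ ->]]; exists i.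
rewrite big_imset /=; last by move=> ? ? _ _; exact: wid_inj.
by apply: eq_bigr => j _; rewrite emb_wid.
Qed.

Variables (U V : 'M[F]_N.+1).
Hypothesis VU : V *m U = 1%:M.

Definition lcoord (j : 'I_k.+1) (x : 'rV[F]_N.+1) : F := (x *m V) 0 (wid j).

Definition onplane (x : 'rV[F]_N.+1) := forall j : 'I_N.+1, (k < j)%N -> (x *m V) 0 j = 0.

Lemma mul_VU (x : 'rV[F]_N.+1) : x *m V *m U = x.
Proof. by rewrite -mulmxA VU mulmx1. Qed.

Lemma meval_onplane e (f : {mpoly F[N.+1]}) x : f \is e.-homog -> onplane x ->
  f.@[fun j => x 0 j] =
  \sum_(m : homon k.+1 e) (lsubst U f)@_(emb (mnm_of m)) * monof lcoord (mnm_of m) x.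
Proof.
move=> Hf ox; rewrite -{1}(mul_VU x) -lsubstE.
by rewrite (meval_supported (lsubst_homog U Hf) ox).
Qed.

Lemma meval_onplane_mpoly (g : {mpoly F[N.+1]}) : exists p : {mpoly F[k.+1]},
  forall x, onplane x -> g.@[fun j => x 0 j] = p.@[fun j => lcoord j x].
Proof.
pose lq := [tuple \sum_(j < k.+1) U (wid j) l *: ('X_j : {mpoly F[k.+1]}) | l < N.+1].
exists (g \mPo lq) => x ox; rewrite comp_mpoly_meval; apply: meval_eq => l.
rewrite tnth_mktuple raddf_sum -{1}(mul_VU x) mxE (big_injl wid_inj) => [|j].
  by apply: eq_bigr => j _; rewrite /= mevalZ mevalXU mulrC.
by rewrite wid_codom -ltnNge => /ox ->; rewrite mul0r.
Qed.

(** The derivative in the normal direction [s] is a combination of the partial derivatives of [f],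
    hence zero at [x]. On the plane only the monomials of [lsubst U f] that are linear in variable
    [s] and free of other normal variables contribute to it. *)
Lemma sing_relation e (f : {mpoly F[N.+1]}) x (s : 'I_N.+1) :
    f \is e.+1.-homog -> onplane x -> (k < s)%N ->
    (forall j, f^`M(j).@[fun j => x 0 j] = 0) ->
  \sum_(m : homon k.+1 e)
    (lsubst U f)@_(emb (mnm_of m) + U_(s)) * monof lcoord (mnm_of m) x = 0.
Proof.
move=> Hf ox lts Hd.
have Hg := dhomog_mderiv s (lsubst_homog U Hf).
have := meval_supported Hg ox; rewrite mderiv_lsubst raddf_sum big1 => [e0|j _]; last first.
  by rewrite /= mevalZ lsubstE mul_VU Hd mulr0.
rewrite [RHS]e0; apply: eq_bigr => m _; congr (_ * _).
(* The integer factor produced by differentiation is 1, since [emb] puts exponent 0 at [s]. *)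
by rewrite -mderiv_lsubst mcoeff_mderiv emb_out.
Qed.

End Restriction.

(** * Parameter count on the plane *)

Section ParameterCount.
Variables (N k i e t : nat) (lekN : (k < N.+1)%N) (U V : 'M[CC]_N.+1).
Hypothesis VU : V *m U = 1%:M.
Variables (iota : 'I_i.+1 -> 'I_k.+1) (M : 'I_t -> homon k.+1 e).

Local Notation y := (lcoord lekN V).
Local Notation coef f m := ((lsubst U f)@_m).
Local Notation conf := ({mpoly CC[N.+1]} * ('I_t -> 'rV[CC]_N.+1))%type.

(* In the coordinates given by [U], the sum is the partial derivative of [f] in
   the direction [s] normal to [P], at a point [x] of [P]. *)
Definition normal_vanish (f : {mpoly CC[N.+1]}) (x : 'rV[CC]_N.+1) :=
  forall s : 'I_N.+1, (k < s)%N ->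
  \sum_(m : homon k.+1 e) coef f (emb N (mnm_of m) + U_(s)) * monof y (mnm_of m) x = 0.

(** What the count uses about [f] once [iota] and [M] are fixed. [C] enters only through its prime
    ideal, two independence statements and the vanishing of normal derivatives. *)
Definition witnessed (f : {mpoly CC[N.+1]}) :=
  [/\ f \is e.+1.-homog,
      forall m : homon k.+1 e.+1, coef f (emb N (mnm_of m)) = 0 &
      exists C : 'rV[CC]_N.+1 -> Prop,
        [/\ primeset (@evfun N.+1) C, algfree C (fun l => y (iota l)),
            lfree C (fun l => monof y (mnm_of (M l))) &
            forall x, C x -> normal_vanish f x]].

(** The points are not tied to any [C]: only the linear conditions they impose on the form, and the
    determinant that makes these solvable, are retained. *)
Definition incident (q : conf) :=
  [/\ q.1 \is e.+1.-homog,
      forall m : homon k.+1 e.+1, coef q.1 (emb N (mnm_of m)) = 0,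
      \det (\matrix_(l, l') monof y (mnm_of (M l')) (q.2 l)) != 0 &
      forall l, normal_vanish q.1 (q.2 l)].

Lemma evfun_lcoord j : evfun (y j).
Proof.
exists (\sum_l V l (wid lekN j) *: 'X_l); apply: functional_extensionality => x.
rewrite /lcoord /ev mxE raddf_sum; apply: eq_bigr => l _ /=.
by rewrite mevalZ mevalXU mulrC.
Qed.

(** A relation is refuted in two stages: independence of [a] gives a form [f] at which some
    coefficient survives, then [sample_points] gives points on the variety [C] of that [f] at which
    the remaining relation between their coordinates fails. *)
Lemma algfree_incident m0 (a : 'I_m0 -> {mpoly CC[N.+1]} -> CC) :
  algfree witnessed a ->
  algfree incident (fun j q => match j : 'I_m0 + 'I_t * 'I_i.+1 with
                               | inl l => a l q.1
                               | inr l => y (iota l.2) (q.2 l.1) end).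
Proof.
move=> fa K.
pose B (b : {ffun 'I_i.+1 -> 'I_K}) := monof (fun l => y (iota l)) (fun l => b l).
pose G (g : {ffun 'I_m0 -> 'I_K} * {ffun 'I_t -> {ffun 'I_i.+1 -> 'I_K}})
       (q : conf) :=
  monof a (fun j => g.1 j) q.1 * \prod_l B (g.2 l) (q.2 l).
pose phi (c : {ffun 'I_m0 + 'I_t * 'I_i.+1 -> 'I_K}) :=
  ([ffun j => c (inl j)], [ffun l => [ffun j => c (inr (l, j))]]) :
  {ffun 'I_m0 -> 'I_K} * {ffun 'I_t -> {ffun 'I_i.+1 -> 'I_K}}.
apply: (@lfree_inj _ _ _ _ _ _ G phi).
- move=> c1 c2 [/ffunP e1 /ffunP e2]; apply/ffunP => -[j|[l j]].
    by have := e1 j; rewrite !ffunE.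
  by have := e2 l; rewrite !ffunE => /ffunP/(_ j); rewrite !ffunE.
- move=> c q _; rewrite /monof big_sumType /=; congr (_ * _).
    by apply: eq_bigr => j _; rewrite ffunE.
  transitivity (\prod_l \prod_j y (iota j) (q.2 l) ^+ c (inr (l, j))).
    by rewrite pair_bigA; apply: eq_bigr => -[].
  by apply: eq_bigr => l _; apply: eq_bigr => j _; rewrite !ffunE.
move=> c Hc [a0 b0]; apply/eqP; apply: contraT => nz.
have [f wf nzf] : exists2 f, witnessed f & \sum_a' c (a', b0) * monof a (fun j => a' j) f != 0.
  apply: NNPP => Nf; case/eqP: nz; apply: (fa K (fun a' => c (a', b0))) => f wf.
  by apply/eqP/negPn/negP => nz; apply: Nf; exists f.
have [Hf Hf0 [C [pC fC fM HC]]] := wf.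
pose c' b := \sum_a' c (a', b) * monof a (fun j => a' j) f.
have HR := @evfun_funring N.+1.
have [||p [Cp nzp detp]] := sample_points HR pC _ _ fM (fC K) (nzf : c' b0 != 0).
- by move=> l; apply: (funring_monof HR) => j; apply: evfun_lcoord.
- by move=> b; apply: (funring_monof HR) => j; apply: evfun_lcoord.
have inc : incident (f, p) by split=> // l; apply: HC.
case/eqP: nzp; rewrite -[RHS](Hc _ inc).
transitivity (\sum_b \sum_a' c (a', b) * G (a', b) (f, p)).
  apply: eq_bigr => b _; rewrite mulr_suml; apply: eq_bigr => a' _.
  by rewrite -mulrA.
by rewrite exchange_big pair_big; apply: eq_bigr => -[].
Qed.

Definition normal_homon (s : 'I_N.+1) (m : homon k.+1 e) : homon N.+1 e.+1 :=
  to_homon (etrans (etrans (mdegD _ _)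
    (congr2 addn (etrans (mdeg_emb lekN _) (mdeg_mnm_of m)) (mdeg1 s))) (addn1 e)).

Lemma normal_homonE s m : mnm_of (normal_homon s m) = (emb N (mnm_of m) + U_(s))%MM.
Proof. by []. Qed.

Lemma normal_homon_inj (s s' : 'I_N.+1) m m' : (k < s)%N ->
  normal_homon s m = normal_homon s' m' -> s = s' /\ m = m'.
Proof.
move=> lts /(congr1 (@mnm_of _ _)); rewrite !normal_homonE => E.
have es : s' = s.
  have := congr1 (fun h : 'X_{1..N.+1} => h s) E; rewrite /= !mnmDE !emb_out // !mnm1E eqxx.
  by case: eqP.
split=> //; rewrite es in E; apply: mnm_of_inj; apply: (emb_inj lekN).
apply/mnmP => j; have := congr1 (fun h : 'X_{1..N.+1} => h j) E.
by rewrite /= !mnmDE => /addIn.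
Qed.

Lemma normal_homon_emb (s : 'I_N.+1) m m' : (k < s)%N -> normal_homon s m != emb_homon lekN m'.
Proof.
move=> lts; apply/eqP => /(congr1 (@mnm_of _ _))/(congr1 (fun h : 'X_{1..N.+1} => h s)).
by rewrite normal_homonE /= mnmDE !emb_out // mnm1E eqxx.
Qed.

Lemma normal_var_subproof (s : 'I_(N - k)) : (k.+1 + s < N.+1)%N.
Proof. by have := ltn_ord s; lia. Qed.

Definition normal_var (s : 'I_(N - k)) : 'I_N.+1 := Ordinal (normal_var_subproof s).

(** The coefficients determined by the others and the points: for each normal direction, [t] linear
    equations in the [t] unknowns indexed by [M]. *)
Definition solved (q : 'I_(N - k) * 'I_t) : homon N.+1 e.+1 :=
  normal_homon (normal_var q.1) (M q.2).

Definition free_coef : finType :=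
  {m : homon N.+1 e.+1 | (m \notin codom (@emb_homon N k lekN e.+1)) &&
                         (m \notin codom solved)}.

Lemma card_free_coef : injective M ->
  (#|free_coef| + (#|homon k.+1 e.+1| + (N - k) * t) = #|homon N.+1 e.+1|)%N.
Proof.
move=> injM.
have inj_s : injective solved.
  move=> [s l] [s' l'] /normal_homon_inj[].
    by rewrite /=; lia.
  move=> /(congr1 val) /= es /injM -> ; congr (_, _); apply: val_inj => /=; lia.
pose A := [set m in codom (@emb_homon N k lekN e.+1)].
pose S := [set m in codom solved].
have dis : [disjoint A & S].
  rewrite -setI_eq0; apply/eqP/setP => m; rewrite !inE; apply/negP => /andP[/codomP[m1 ->]].
  move=> /codomP[[s l] E]; have lts : (k < normal_var s)%N by rewrite /=; lia.
  by have := normal_homon_emb (M l) m1 lts; rewrite E eqxx.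
have cA : #|A| = #|homon k.+1 e.+1|.
  by rewrite cardsE card_codom //; apply: emb_homon_inj.
have cS : #|S| = ((N - k) * t)%N.
  by rewrite cardsE card_codom // card_prod !card_ord.
rewrite -cA -cS -cardsUI (disjoint_setI0 dis) cards0 addn0.
rewrite -[RHS](cardsC (A :|: S)) addnC; congr (_ + _)%N.
rewrite card_sig; apply: eq_card => m.
by rewrite !inE negb_or.
Qed.

Definition param : finType := ('I_t * 'I_k.+1 + free_coef)%type.

Definition paramf (j : 'I_#|param|) (q : conf) :=
  match enum_val j with
  | inl l => y l.2 (q.2 l.1)
  | inr m => coef q.1 (mnm_of (val m))
  end.

Lemma polyon_point l j : polyon incident paramf (fun q => y j (q.2 l)).
Proof.
apply: polyon_ext (polyon_param _ _ (enum_rank (inl (l, j) : param))) => q _.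
by rewrite /paramf enum_rankK.
Qed.

Lemma polyon_free m (Hm : (m \notin codom (@emb_homon N k lekN e.+1)) &&
                          (m \notin codom solved)) :
  polyon incident paramf (fun q => coef q.1 (mnm_of m)).
Proof.
apply: polyon_ext (polyon_param _ _ (enum_rank (inr (exist _ m Hm) : param))) => q _.
by rewrite /paramf enum_rankK.
Qed.

Definition delta (q : conf) :=
  \det (\matrix_(l, l') monof y (mnm_of (M l')) (q.2 l)).

Let Rpoly := polyon_funring incident paramf.

Lemma polyon_monof m l : polyon incident paramf (fun q => monof y m (q.2 l)).
Proof.
by apply: (funring_prod Rpoly) => j _; apply: (funring_exp Rpoly); apply: polyon_point.
Qed.

Lemma polyon_delta : polyon incident paramf delta.
Proof. by apply: (funring_det Rpoly) => l l'; apply: polyon_monof. Qed.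

(* Cramer's rule for the linear conditions that the points [q.2 l] impose on [q.1]. *)
Lemma polyon_solved (s : 'I_N.+1) l' : (k < s)%N -> injective M ->
  polyon incident paramf (fun q => delta q * coef q.1 (mnm_of (normal_homon s (M l')))).
Proof.
move=> lts injM.
(* The part of the equation at point [l] whose coefficients are free parameters. *)
pose rhs l (q : conf) := \sum_(m | m \notin codom M)
  - (coef q.1 (mnm_of (normal_homon s m)) * monof y (mnm_of m) (q.2 l)).
have Prhs l : polyon incident paramf (rhs l).
  apply: (funring_sum Rpoly) => m Nm.
  have -> : (fun q => - (coef q.1 (mnm_of (normal_homon s m)) * monof y (mnm_of m) (q.2 l))) =
     (fun q : conf =>
        -1 * (coef q.1 (mnm_of (normal_homon s m)) * monof y (mnm_of m) (q.2 l))).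
    by apply: functional_extensionality => q; rewrite mulN1r.
  apply: (funring_mul Rpoly (funring_cst Rpoly _)).
  apply: (funring_mul Rpoly) (polyon_monof _ _); apply: polyon_free.
  apply/andP; split; apply/negP => /codomP.
    by move=> [m' /eqP]; rewrite (negPf (normal_homon_emb _ _ lts)).
  move=> [[s' h]] /(normal_homon_inj lts)[_ em].
  by rewrite em codom_f in Nm.
pose Mx (q : conf) := \matrix_(l, l') monof y (mnm_of (M l')) (q.2 l) : 'M[CC]_t.
have H : polyon incident paramf (fun q => \sum_l (\adj (Mx q)) l' l * rhs l q).
  apply: (funring_sum Rpoly) => l _; apply: (funring_mul Rpoly) (Prhs l).
  by apply: (funring_adj _ _ Rpoly) => a b; apply: polyon_monof.
apply: polyon_ext H => q [_ _ _ Hq].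
pose c : 'cV[CC]_t := \col_h coef q.1 (mnm_of (normal_homon s (M h))).
have Mc : Mx q *m c = \col_l rhs l q.
  apply/colP => l; rewrite !mxE /rhs sumrN; apply/eqP; rewrite -addr_eq0; apply/eqP.
  rewrite -[RHS](Hq l s lts) [RHS](bigID (mem (codom M))) /=; congr (_ + _).
  transitivity (\sum_(m in [set M h | h in 'I_t])
      coef q.1 (emb N (mnm_of m) + U_(s)) * monof y (mnm_of m) (q.2 l)); last first.
    by apply: eq_bigl => m; apply/imsetP/codomP => [[h _ ->]|[h ->]]; exists h.
  rewrite big_imset /=; last by move=> ? ? _ _; apply: injM.
  by apply: eq_bigr => h _; rewrite !mxE mulrC.
have := congr1 (fun W : 'cV_t => W l' 0) (congr1 (mulmx (\adj (Mx q))) Mc).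
rewrite /= mulmxA mul_adj_mx mul_scalar_mx => E.
transitivity ((\adj (Mx q) *m \col_l rhs l q) l' 0); last by rewrite -E !mxE.
by rewrite mxE; apply: eq_bigr => l _; congr (_ * _); rewrite mxE.
Qed.

(** The independent functions of [algfree_incident] are rational in [param] with denominator
    [delta]. The coefficients that vanish and those that are solved are moved to the left so that no
    subtraction appears. *)
Lemma parameter_count m0 (a : 'I_m0 -> {mpoly CC[N.+1]} -> CC) :
    (forall j, coord_fun (a j)) -> algfree witnessed a ->
  (m0 + t * i.+1 + (#|homon k.+1 e.+1| + (N - k) * t) <=
   t * k.+1 + #|homon N.+1 e.+1|)%N.
Proof.
move=> ca fa.
have [f [_ _ [C [_ _ fM _]]]] : exists f, witnessed f.
  apply: NNPP => Nf; have := fa 1%N (fun=> 1) _ [ffun=> ord0].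
  move/(_ _)/eqP; rewrite oner_eq0 => H; apply: notF; apply: H => f wf.
  by case: Nf; exists f.
have injM : injective M by move=> l l' E; apply: (lfree_injective fM); rewrite E.
have [D HD] := polyon_delta.
have Dnz q : incident q -> D.@[fun j => paramf j q] != 0.
  by move=> inc; rewrite -HD //; case: inc.
have Rq := quotpoly_funring incident paramf D.
have qcoef (m : homon N.+1 e.+1) : quotpoly incident paramf D (fun q => coef q.1 (mnm_of m)).
  have [/codomP[m' ->]|N1] := boolP (m \in codom (@emb_homon N k lekN e.+1)).
    apply: quotpoly_ext (funring_cst Rq 0) => q [_ H0 _ _]; exact/esym/H0.
  have [/codomP[[s l] ->]|N2] := boolP (m \in codom solved); last first.
    by apply: quotpoly_polyon; apply: polyon_free; rewrite N1.
  apply: quotpoly_div; have lts : (k < normal_var s)%N by rewrite /=; lia.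
  by apply: polyon_ext (polyon_solved l lts injM) => q inc; rewrite -HD.
(* The original coefficients are linear in those of [lsubst U f], by the inverse substitution. *)
have qmcoef m : quotpoly incident paramf D (fun q => q.1@_m).
  apply: (@quotpoly_ext _ _ _ _ _ _ (fun q => \sum_(m' : homon N.+1 e.+1)
      coef q.1 (mnm_of m') * (lsubst V 'X_[mnm_of m'])@_m)).
    move=> q [Hq _ _ _]; rewrite -{2}(lsubstK q.1 VU) {2}(homog_expand (lsubst_homog U Hq)).
    rewrite lsubst_sum raddf_sum; apply: eq_bigr => m' _.
    by rewrite lsubstZ /= mcoeffZ.
  apply: (funring_sum Rq) => m' _; apply: (funring_mul Rq) => //.
  exact: (funring_cst Rq).
have qa b : coord_fun b -> quotpoly incident paramf D (fun q => b q.1).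
  elim=> [c|m|b1 b2 _ H1 _ H2|b1 b2 _ H1 _ H2].
  - exact: (funring_cst Rq).
  - exact: qmcoef.
  - exact: (funring_add Rq).
  - exact: (funring_mul Rq).
have {}qa (j : 'I_m0 + 'I_t * 'I_i.+1) : quotpoly incident paramf D
    (fun q => match j with inl l => a l q.1 | inr l => y (iota l.2) (q.2 l.1) end).
  case: j => [j|[l j]]; first exact: qa.
  exact/quotpoly_polyon/polyon_point.
have := algfree_param Dnz qa (algfree_incident fa).
rewrite !card_sum !card_prod !card_ord -(card_free_coef injM); lia.
Qed.

End ParameterCount.

(** * Reduction of the set to witnessed forms *)

Section Plane.
Variables (N k : nat) (P : 'M[CC]_N.+1).
Hypothesis rkP : \rank P = k.+1.

Lemma rank_lt : (k < N.+1)%N.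
Proof. by rewrite -rkP rank_leq_row. Qed.

(** An invertible matrix whose first [k + 1] rows form a basis of [P]. *)
Definition planeU := row_ebase P.
Definition planeV := invmx planeU.

Local Notation y := (lcoord rank_lt planeV).

Lemma planeVU : planeV *m planeU = 1%:M.
Proof. exact: mulVmx (row_ebase_unit P). Qed.

Lemma planeUV : planeU *m planeV = 1%:M.
Proof. exact: mulmxV (row_ebase_unit P). Qed.

Lemma onplane_sub (x : 'rV[CC]_N.+1) : (x <= P)%MS -> onplane k planeV x.
Proof.
case/submxP => w -> j ltj; rewrite -(mulmx_ebase P) -/planeU -!mulmxA planeUV mulmx1.
rewrite mulmxA mxE big1 // => h _; rewrite [pid_mx _ h j]mxE rkP.
rewrite (_ : _ && _ = false) ?mulr0 //; apply/negP => /andP[/eqP->].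
by rewrite ltnS leqNgt ltj.
Qed.

Lemma row_planeU_sub (j : 'I_k.+1) : (row (wid rank_lt j) planeU <= P)%MS.
Proof.
have E : pid_mx (\rank P) *m planeU = invmx (col_ebase P) *m P.
  by rewrite -[X in _ = _ *m X](mulmx_ebase P) -mulmxA mulKmx ?col_ebase_unit.
have -> : row (wid rank_lt j) planeU = row (wid rank_lt j) (invmx (col_ebase P)) *m P.
  rewrite -row_mul -E row_mul [LHS]rowE; congr (_ *m _); apply/rowP => l.
  have lt : (wid rank_lt j < k.+1)%N := ltn_ord j.
  by rewrite !mxE rkP eqxx lt andbT eq_sym.
exact: submxMl.
Qed.

(** A linear relation between the coordinates on [C] puts [C] in the kernel of a linear form [w],
    hence puts [P] there. Evaluating at the basis vectors of [P] shows that its coefficients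
    vanish. *)
Lemma lfree_span (C : 'rV[CC]_N.+1 -> Prop) : span_eq C P -> lfree C y.
Proof.
move=> [_ minP] c Hc.
pose c' (j : 'I_N.+1) := if insub (val j) is Some j' then c j' else 0.
pose w : 'cV[CC]_N.+1 := planeV *m \col_j c' j.
have CwE x : (x *m w) 0 0 = \sum_j c j * y j x.
  rewrite /w mulmxA mxE (big_injl (@wid_inj _ _ rank_lt)) => [|j].
    apply: eq_bigr => j _; rewrite [X in _ * X = _]mxE mulrC; congr (_ * _).
    by rewrite /c' [insub _](valK j).
  rewrite wid_codom -ltnNge [X in _ -> _ * X = _]mxE => ltj.
  by rewrite /c' insubF ?mulr0 // ltnS leqNgt ltj.
have sub : (P <= kermx w)%MS.
  apply: minP => x Cx; apply/sub_kermxP/matrixP => a b; rewrite !ord1 CwE mxE.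
  exact: Hc.
move=> j; have := sub_kermxP (submx_trans (row_planeU_sub j) sub).
move/matrixP/(_ 0 0); rewrite CwE mxE => E; rewrite -[RHS]E (bigD1 j) //= big1.
  by rewrite /lcoord -row_mul planeUV !mxE eqxx mulr1 addr0.
move=> l nl; rewrite /lcoord -row_mul planeUV !mxE (inj_eq (@wid_inj _ _ _)).
by rewrite eq_sym (negPf nl) mulr0.
Qed.

Lemma chain_lcoord_algfree (C : 'rV[CC]_N.+1 -> Prop) i :
    subs C (fun x => (x <= P)%MS) -> chain_in (@proj_closed N.+1) C i ->
  exists2 iota : 'I_i.+1 -> 'I_k.+1, injective iota & algfree C (fun l => y (iota l)).
Proof.
move=> sub /chain_proj_algfree[h [eh fh]]; apply: algfree_coordinates fh => j.
have [g ->] := eh j; have [p Hp] := meval_onplane_mpoly rank_lt planeVU g.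
by exists p => x Cx; apply: Hp; apply: onplane_sub; apply: sub.
Qed.

(** On a [k]-dimensional [B] inside [P] all [k + 1] coordinates are algebraically independent, so
    the restriction of [f] to [P], which vanishes on [B], is the zero form. *)
Lemma restriction_eq0 d (f : {mpoly CC[N.+1]}) (B : 'rV[CC]_N.+1 -> Prop) :
    f \is d.-homog -> subs B (SingRestr f P) -> chain_in (@proj_closed N.+1) B k ->
  forall m : homon k.+1 d, (lsubst planeU f)@_(emb N (mnm_of m)) = 0.
Proof.
move=> Hf subB ch.
have subP : subs B (fun x => (x <= P)%MS) by move=> x /subB[].
have [iota inj fB] := chain_lcoord_algfree subP ch.
have bij : bijective iota by apply: injF_bij.
pose phi (m : homon k.+1 d) : {ffun 'I_k.+1 -> 'I_d.+1} :=
  [ffun l => inord (mnm_of m (iota l))].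
have phiE m l : phi m l = mnm_of m (iota l) :> nat.
  rewrite ffunE inordK // ltnS -[X in (_ <= X)%N](mdeg_mnm_of m) mdegE.
  by rewrite (bigD1 (iota l)) //= leq_addr.
have : lfree B (fun m : homon k.+1 d => monof y (mnm_of m)).
  apply: lfree_inj (phi) _ _ (fB d.+1).
    move=> m1 m2 /ffunP E; apply: mnm_of_inj; apply/mnmP => j; case: bij => io' _ K.
    by rewrite -(K j) -!phiE E.
  move=> m x _; rewrite /monof (reindex iota) /=; last exact: onW_bij.
  by apply: eq_bigr => l _; rewrite phiE.
apply=> x Bx; rewrite -(meval_onplane rank_lt planeVU Hf).
  by case: (subB x Bx).
exact/onplane_sub/subP.
Qed.

(** Each term of the maximum comes with its own independent forms: those of [hilbert_linear], or the
    monomials in the coordinates [iota]. In both cases [lfree_subfamily] extracts monomials. *)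
Lemma tau_monomials (C : 'rV[CC]_N.+1 -> Prop) e i (iota : 'I_i.+1 -> 'I_k.+1) :
    primeset (@evfun N.+1) C -> (exists x, C x) -> lfree C y ->
    algfree C (fun l => y (iota l)) ->
  exists M : 'I_(tau e k i) -> homon k.+1 e, lfree C (fun l => monof y (mnm_of (M l))).
Proof.
move=> pC nC fy fC.
suff [G fG WG] : exists2 G : 'I_(tau e k i) -> 'rV[CC]_N.+1 -> CC, lfree C G &
    forall l, inspan C (fun m : homon k.+1 e => monof y (mnm_of m)) (G l).
  by have [M _ fM] := lfree_subfamily WG fG; exists M.
rewrite /tau; case: (leqP 'C(e + i, i) (e * k + 1)) => _.
  rewrite addn1; apply: hilbert_linear (@evfun_funring _) pC _ _ _ nC _ fy.
  exact: evfun_lcoord.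
have cH : #|homon i.+1 e| = 'C(e + i, i) by rewrite card_homon -bin_sub ?leq_addr // addKn.
exists (fun l => monof (fun j => y (iota j)) (mnm_of (enum_val (cast_ord (esym cH) l)))).
  pose phi (l : 'I_('C(e + i, i))) : {ffun 'I_i.+1 -> 'I_e.+1} :=
    [ffun j => inord (mnm_of (enum_val (cast_ord (esym cH) l)) j)].
  have phiE l j : phi l j = mnm_of (enum_val (cast_ord (esym cH) l)) j :> nat.
    set m := enum_val _; rewrite ffunE inordK // ltnS -[X in (_ <= X)%N](mdeg_mnm_of m) mdegE.
    by rewrite (bigD1 j) //= leq_addr.
  apply: lfree_inj (phi) _ _ (fC e.+1).
    move=> l1 l2 /ffunP E; apply: (@cast_ord_inj _ _ (esym cH)); apply: enum_val_inj.
    by apply: mnm_of_inj; apply/mnmP => j; rewrite -!phiE E.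
  by move=> l x _; apply: eq_bigr => j _; rewrite phiE.
move=> l; set m := mnm_of _.
pose m' : 'X_{1..k.+1} := [multinom (\sum_(h | iota h == j) m h)%N | j < k.+1].
have dm' : mdeg m' = e.
  rewrite mdegE -[RHS](mdeg_mnm_of (enum_val (cast_ord (esym cH) l))) mdegE.
  rewrite [RHS](partition_big iota xpredT) //=.
  by apply: eq_bigr => j _; rewrite mnmE.
apply: inspan_ext (inspan_gen _ _ (to_homon dm')) => x _.
rewrite /monof (partition_big iota xpredT) //=; apply: eq_bigr => j _.
by rewrite mnmE -prodrXr; apply: eq_bigr => h /eqP ->.
Qed.

(** [iota] and [M] are finite functions, so the choices form a finite type over which a product can
    be taken. *)
Lemma sigma_set_witnessed e i (f : {mpoly CC[N.+1]}) :
  sigma_set N e.+1 i k P f ->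
  exists (iota : {ffun 'I_i.+1 -> 'I_k.+1}) (M : {ffun 'I_(tau e k i) -> homon k.+1 e}),
    witnessed rank_lt planeU planeV iota M f.
Proof.
move=> [Pf [C [[irrC subC _] CP [chC _] spanC [B [[irrB subB _] [chB _] _]]]]].
have [iota inj fC] := chain_lcoord_algfree CP chC.
have pC := primeset_proj irrC.
have [M fM] := tau_monomials e pC (let: And3 _ h _ := irrC in h) (lfree_span spanC) fC.
exists [ffun l => iota l], [ffun l => M l]; split=> //.
  exact: restriction_eq0 Pf subB chB.
exists C; split=> //.
- by congr algfree: fC; apply: functional_extensionality => l; rewrite ffunE.
- by congr lfree: fM; apply: functional_extensionality => l; rewrite ffunE.
move=> x Cx s lts; apply: sing_relation planeVU _ _ _ _ Pf _ lts _.
  exact/onplane_sub/CP.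
by move=> j; have [_ _ H] := subC x Cx; exact: H.
Qed.

End Plane.

Theorem theorem1p3 (d N i k : nat) (P : 'M[CC]_N.+1) :
  (4 <= d)%N -> (1 <= i)%N -> (i <= k)%N -> (k <= N)%N -> (2 * k <= N + i)%N ->
  \rank P = k.+1 ->
  codim_geq N.+1 d (Pikl N d i k P)
    ('C(d + k, k) + (N + i - 2 * k) * tau (d - 1) k i)%N.
Proof.
case: d => // e _ _ leik lekN le2k rkP; rewrite subn1 /=.
move=> D m [_ maxD] [chm _]; rewrite leqNgt; apply/negP => ltD.
set t := tau e k i in ltD.
have leD : (#|homon N.+1 e.+1| <= D)%N.
  rewrite leqNgt; apply/negP => lt; apply: maxD.
  have [c [irrc subc]] := chain_Pd N.+1 e.+1.
  exists c; split=> j le; [apply: irrc|apply: subc]; exact: leq_trans le lt.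
have [Z [a [irrZ subZ ca fa]]] := chain_coord_algfree chm.
have cHk : #|homon k.+1 e.+1| = 'C(e.+1 + k, k) by rewrite card_homon -bin_sub ?leq_addr // addKn.
have HR := @coord_fun_funring N.+1.
(* With [m] this large, [parameter_count] forbids independence of [a] on the forms witnessed by [q];
   the resulting relation [u] is nonzero on [Z], where [a] is independent. *)
have /fin_all_exists[u Hu] (q : {ffun 'I_i.+1 -> 'I_k.+1} * {ffun 'I_t -> homon k.+1 e}) :
    exists u, [/\ coord_fun u,
      vanish (witnessed (rank_lt rkP) (planeU P) (planeV P) q.1 q.2) u & ~ vanish Z u].
  have [K] : exists K, ~ lfree (witnessed (rank_lt rkP) (planeU P) (planeV P) q.1 q.2)
      (fun b : {ffun 'I_m -> 'I_K} => monof (fun j : 'I_m => a j) (fun j => b j)).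
    apply: not_all_ex_not => fw.
    have := parameter_count (planeVU P) (fun j : 'I_m => ca j) fw.
    (* The truncated subtraction is exact because [2 * k <= N + i]. *)
    have E : ((N + i - 2 * k) * t + k * t = (N - k) * t + i * t)%N.
      by rewrite -!mulnDl; congr (_ * _)%N; lia.
    rewrite cHk !mulnS; lia.
  case/not_lfree => c [Vc [b nzb]].
  exists (fun f => \sum_b c b * monof (fun j : 'I_m => a j) (fun j => b j) f); split=> //.
    by apply: (funring_comb HR) => b'; apply: (funring_monof HR).
  by move/fa/(_ b)/eqP; rewrite (negPf nzb).
pose v f := \prod_q u q f.
have cv : coord_fun v by apply: (funring_prod HR) => q _; case: (Hu q).
have nZ : exists f, Z f by case: irrZ.
have Vv : vanish Z v.
  (* The closure is crossed twice: [Pikl] is already a closure, and [codim_geq] closes it again. *)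
  move=> f /subZ; apply: vanish_zclosure (cv) _ f => [f|].
    by apply: zclosure_Pd => g [].
  apply: vanish_zclosure (cv) _ => [f []//|f /(sigma_set_witnessed rkP)[iota [M wf]]].
  have [_ Vu _] := Hu (iota, M).
  by rewrite /v (bigD1 (iota, M)) //= Vu // mul0r.
have [q|q Vq] := primeset_prod HR (primeset_irreducible irrZ) nZ _ Vv.
  by case: (Hu q).
by case: (Hu q).
Qed.
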